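(* Let $n, m, c_1, c_2$ be positive integers with $c_1\ge c_2$ and $2c_2-c_1>2n-2$. Let $G=\mathbf{Z}\stackrel{n}{*}\mathbf{Z}\stackrel{n}{*}\cdots\stackrel{n}{*}\mathbf{Z}$ be the $n$th nilpotent product of $m$ copies of the infinite cyclic group $\mathbf{Z}$, with free presentation $1\to\gamma_{n+1}(F)\to F\to G\to 1$, where $F$ is the free group on $X=\{x_1,\ldots,x_m\}$. Let $\mathcal{V}$ be the variety of groups defined by the set of words $\{[\gamma_{c_1+1},\gamma_{c_2+1}]\}$. Then the Baer invariant $\mathcal{V}M(G)$ is a free abelian group with the basis $$D=\{\,a\,[\gamma_{c_1+n+1}(F),\gamma_{c_2+1}(F)]\,[\gamma_{c_2+n+1}(F),\gamma_{c_1+1}(F)] \ :\ a\in A- C\,\},$$ where $A- C$ is the set difference of the sets of commutators $A$ and $C$ defined in the context.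
   Context: Baer invariant: if $G\cong F/R$ with $F$ free and $\mathcal{V}$ is a variety defined by a set of words $V$, then $\mathcal{V}M(G)=\dfrac{R\cap V(F)}{[RV^*F]}$, where $V(F)$ is the verbal subgroup of $F$ and $[RV^*F]$ is the subgroup generated by all $v(f_1,\ldots,f_{i-1},f_ir,f_{i+1},\ldots,f_k)\,v(f_1,\ldots,f_i,\ldots,f_k)^{-1}$ with $r\in R$, $v\in V$, $f_j\in F$, $1\le i\le k$, $k\in\mathbf{N}$. The word $\gamma_c$ is the left-normed commutator $[x_1,\ldots,x_c]$, and $[\gamma_{c_1+1},\gamma_{c_2+1}]$ is the word $[[x_1,\ldots,x_{c_1+1}],[y_1,\ldots,y_{c_2+1}]]$ in distinct variables; $\gamma_k(F)$ is the $k$th term of the lower central series of $F$. The $n$th nilpotent product of groups $G_1,\ldots,G_m$ is $P/(\gamma_{n+1}(P)\cap[G_i]^* )$, where $P$ is the free product of the $G_i$ and $[G_i]^*$ is the normal closure in $P$ of the subgroups $[G_i,G_j]$, $i\ne j$. For $G_i=\mathbf{Z}$ this is the free nilpotent group $F/\gamma_{n+1}(F)$ of class $n$ and rank $m$. With this presentation ($R=\gamma_{n+1}(F)$) and under the hypotheses, $\mathcal{V}M(G)=\dfrac{[\gamma_{c_1+1}(F),\gamma_{c_2+1}(F)]}{[\gamma_{c_1+n+1}(F),\gamma_{c_2+1}(F)][\gamma_{c_2+n+1}(F),\gamma_{c_1+1}(F)]}$. Basic commutators on the totally ordered set $X$ are defined inductively with their weights $wt$: elements of $X$ are the basic commutators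 of weight $1$; $[b,a]$ is a basic commutator of weight $k>1$ if $a,b$ are basic commutators with $wt(a)+wt(b)=k$, $a<b$, and if $b=[b_1,b_2]$ then $b_2\le a$. Basic commutators are totally ordered so that those of smaller weight precede those of larger weight, and those of equal weight are ordered lexicographically: $[b_1,a_1]<[b_2,a_2]$ if $b_1<b_2$, or $b_1=b_2$ and $a_1<a_2$. $A$ is the set of commutators $[\beta,\alpha]$ with $\beta,\alpha$ basic commutators on $X$, $\beta>\alpha$, $c_1+1\le wt(\beta)\le c_1+n$, $c_2+1\le wt(\alpha)\le c_2+n$. $C$ is the set of commutators $[\beta,\alpha]$ with $\beta,\alpha$ basic commutators on $X$, $\beta>\alpha$, $c_2+n+1\le wt(\beta)$, $c_1+1\le wt(\alpha)$, $wt(\beta)+wt(\alpha)\le 2n+c_1+c_2+1$. *)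

(* Defs.v *)
From HB Require Import structures.
From mathcomp Require Import all_boot all_order all_algebra.
From mathcomp Require Import boolp classical_sets.

Set Implicit Arguments.
Unset Strict Implicit.
Unset Printing Implicit Defensive.

Local Open Scope quotient_scope.
Local Open Scope classical_set_scope.
Local Open Scope group_scope.

Notation grhom G H := (UMagmaMorphism.type G H).

Section Subgroups.
Variable G : groupType.
Implicit Types (A B N S : set G) (x y g : G).

Definition subgroup S : Prop :=
  S 1 /\ (forall x y, S x -> S y -> S (x * y^-1)).

Definition normal N : Prop :=
  subgroup N /\ (forall x g, N x -> N (x ^ g)).

Definition gen A : set G := smallest subgroup A.

Definition normal_closure A : set G := smallest normal A.

Definition commg_sub A B : set G := gen [set [~ a, b] | a in A & b in B].

(* Indexed from 1: lcs 1 is the whole group (lcs 0 is a junk value). *)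
Definition lcs (k : nat) : set G :=
  iter k.-1 (fun H => commg_sub H setT) setT.

Definition mulset A B : set G := [set a * b | a in A & b in B].

Definition left_coset x A : set G := [set x * a | a in A].

Definition zexpg x (k : int) : G :=
  match k with Posz n => x ^+ n | Negz n => x ^- n.+1 end.

Definition free_abelian_with_basis S B : Prop :=
  [/\ forall x y, S x -> S y -> commute x y,
      gen B = S
    & forall (s : seq G) (k : G -> int), uniq s ->
        (forall b, b \in s -> B b) ->
        \prod_(b <- s) zexpg b (k b) = 1 ->
        forall b, b \in s -> k b = Posz 0].

Lemma subgroup1 S : subgroup S -> S 1.
Proof. by case. Qed.

Lemma subgroupV S x : subgroup S -> S x -> S x^-1.
Proof. by move=> [S1 SF] Sx; rewrite -[x^-1]mul1g; apply: SF. Qed.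

Lemma subgroupM S x y : subgroup S -> S x -> S y -> S (x * y).
Proof.
move=> sS Sx Sy; rewrite -[y]invgK; case: (sS) => _; apply=> //.
exact: subgroupV.
Qed.

Lemma gen_subgroup A : subgroup (gen A).
Proof.
split=> [S [[S1 _] _] //|x y Ax Ay S HS]; case: (HS) => -[_ SF] _.
by apply: SF; [apply: Ax | apply: Ay].
Qed.

Lemma sub_gen A : A `<=` gen A.
Proof. exact: sub_gen_smallest. Qed.

Lemma gen_sub A S : subgroup S -> A `<=` S -> gen A `<=` S.
Proof. exact: smallest_sub. Qed.

Lemma gen_normal A : (forall x g, A x -> A (x ^ g)) -> normal (gen A).
Proof.
move=> AJ; split; first exact: gen_subgroup.
move=> x g Ax.
suff : gen A `<=` [set y | gen A (y ^ g)] by apply.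
apply: gen_sub => [|y Ay]; last by apply: sub_gen; apply: AJ.
split=> [|y z /= Ay Az]; first by rewrite /= conj1g; case: (gen_subgroup A).
by rewrite conjMg conjVg; case: (gen_subgroup A) => _; apply.
Qed.

Lemma normal_closure_normal A : normal (normal_closure A).
Proof.
split; last by move=> x g Ax N NA; case: (NA) => -[_ NJ] _; apply: NJ; apply: Ax.
split=> [N [[[N1 _] _] _] //|x y Ax Ay N NA]; case: (NA) => -[[_ NF] _] _.
by apply: NF; [apply: Ax | apply: Ay].
Qed.

Lemma commg_sub_normal A B : normal A -> normal B -> normal (commg_sub A B).
Proof.
move=> [_ AJ] [_ BJ]; apply: gen_normal => x g [a Aa [b Bb <-]].
by exists (a ^ g); [apply: AJ | exists (b ^ g); [apply: BJ | rewrite conjRg]].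
Qed.

Lemma setT_normal : normal setT.
Proof. by []. Qed.

Lemma lcs_normal k : normal (lcs k).
Proof.
rewrite /lcs; elim: k.-1 => [|j IH] //=.
exact: commg_sub_normal.
Qed.

Lemma setI_normal A B : normal A -> normal B -> normal (A `&` B).
Proof.
move=> [[A1 AF] AJ] [[B1 BF] BJ]; split; last first.
  by move=> x g [Ax Bx]; split; [apply: AJ | apply: BJ].
split=> // x y [Ax Bx] [Ay By].
by split; [apply: AF | apply: BF].
Qed.

End Subgroups.

Arguments lcs : clear implicits.

Section Quotient.
Variables (G : groupType) (N : set G) (nN : normal N).

Definition coset_rel (x y : G) : bool := `[< N (x^-1 * y) >].

Lemma coset_relP : equiv_class_of coset_rel.
Proof.
case: (nN) => sN NJ; split.
- by move=> x; apply/asboolP; rewrite mulVg; apply: subgroup1.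
- suff H x y : coset_rel x y -> coset_rel y x.
    by move=> x y; apply/idP/idP; apply: H.
  move=> /asboolP Nxy; apply/asboolP.
  by rewrite -[_ * _]invgK invgM invgK; apply: subgroupV.
- move=> y x z /asboolP Nxy /asboolP Nyz; apply/asboolP.
  by rewrite -(mulVKg y z) mulgA; apply: subgroupM.
Qed.

Definition coset_equiv := EquivRelPack coset_relP.

Definition quotg : Type := {eq_quot coset_equiv}.

HB.instance Definition _ := Choice.on quotg.
HB.instance Definition _ := EqQuotient.on quotg.

Definition quot_proj (x : G) : quotg := \pi_quotg x.

Lemma quot_projP x y : quot_proj x = quot_proj y <-> N (x^-1 * y).
Proof.
split=> [/eqmodP /asboolP //|Nxy]; apply/eqmodP.
exact/asboolP.
Qed.

Lemma quot_reprK (a : quotg) : quot_proj (repr a) = a.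
Proof. exact: reprK. Qed.

Definition quotg_one : quotg := quot_proj 1.
Definition quotg_mul (a b : quotg) : quotg := quot_proj (repr a * repr b).
Definition quotg_inv (a : quotg) : quotg := quot_proj (repr a)^-1.

Lemma quot_projM x y : quot_proj (x * y) = quotg_mul (quot_proj x) (quot_proj y).
Proof.
case: (nN) => sN NJ; apply/quot_projP.
have /quot_projP Nx := esym (quot_reprK (quot_proj x)).
have /quot_projP Ny := esym (quot_reprK (quot_proj y)).
set x' := repr (quot_proj x) in Nx *; set y' := repr (quot_proj y) in Ny *.
have -> : (x * y)^-1 * (x' * y') = (x^-1 * x') ^ y * (y^-1 * y').
  by rewrite /conjg invgM !mulgA mulgK.
by apply: subgroupM => //; apply: NJ.
Qed.

Lemma quot_projV x : quot_proj x^-1 = quotg_inv (quot_proj x).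
Proof.
case: (nN) => sN NJ; apply/quot_projP.
have /quot_projP Nx := esym (quot_reprK (quot_proj x)).
set x' := repr (quot_proj x) in Nx *.
have -> : x^-1^-1 * x'^-1 = ((x^-1 * x')^-1) ^ (x^-1).
  by rewrite /conjg invgM !invgK !mulgA mulgK.
by apply: NJ; apply: subgroupV.
Qed.

Lemma quotg_mulA : associative quotg_mul.
Proof.
move=> a b c; rewrite -(quot_reprK a) -(quot_reprK b) -(quot_reprK c).
by rewrite -!quot_projM mulgA.
Qed.

Lemma quotg_mul1 : left_id quotg_one quotg_mul.
Proof. by move=> a; rewrite -(quot_reprK a) -quot_projM mul1g. Qed.

Lemma quotg_1mul : right_id quotg_one quotg_mul.
Proof. by move=> a; rewrite -(quot_reprK a) -quot_projM mulg1. Qed.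

Lemma quotg_mulV : left_inverse quotg_one quotg_inv quotg_mul.
Proof.
by move=> a; rewrite -(quot_reprK a) -quot_projV -quot_projM mulVg.
Qed.

Lemma quotg_Vmul : right_inverse quotg_one quotg_inv quotg_mul.
Proof.
by move=> a; rewrite -(quot_reprK a) -quot_projV -quot_projM mulgV.
Qed.

HB.instance Definition _ :=
  isGroup.Build quotg quotg_mulA quotg_mul1 quotg_1mul quotg_mulV quotg_Vmul.

Lemma quot_proj_monoid_morphism : monoid_morphism quot_proj.
Proof. by split=> // x y; apply: quot_projM. Qed.

HB.instance Definition _ :=
  isUMagmaMorphism.Build G quotg quot_proj quot_proj_monoid_morphism.

End Quotient.

Definition kernel (G H : groupType) (f : grhom G H) : set G :=
  [set x | f x = 1].

Lemma kernel_normal (G H : groupType) (f : grhom G H) : normal (kernel f).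
Proof.
split; last by move=> x g fx; apply: etrans (gmulfJ _ _ _) _; rewrite fx conj1g.
split=> [|x y fx fy]; first exact: gmulf1.
by apply: etrans (gmulfF _ _ _) _; rewrite fx fy mulgV.
Qed.

Definition is_free_group (I : Type) (F : groupType) (x : I -> F) : Prop :=
  forall (H : groupType) (h : I -> H), exists f : grhom F H,
    (forall i, f (x i) = h i) /\
    (forall g : grhom F H, (forall i, g (x i) = h i) -> g =1 f).

Definition is_free_product (I : Type) (G : I -> groupType) (P : groupType)
    (inj : forall i, grhom (G i) P) : Prop :=
  forall (H : groupType) (h : forall i, grhom (G i) H), exists f : grhom P H,
    (forall i y, f (inj i y) = h i y) /\
    (forall g : grhom P H, (forall i y, g (inj i y) = h i y) -> g =1 f).

Section NilpotentProduct.
Variables (n : nat) (I : Type) (G : I -> groupType) (P : groupType).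
Variable inj : forall i, grhom (G i) P.

Definition cartesian_sub : set P :=
  normal_closure [set z | exists i j, i <> j /\
    commg_sub (range (inj i)) (range (inj j)) z].

Lemma nilpotent_product_normal : normal (lcs P n.+1 `&` cartesian_sub).
Proof.
by apply: setI_normal; [apply: lcs_normal | apply: normal_closure_normal].
Qed.

Definition nilpotent_product : groupType := quotg nilpotent_product_normal.

End NilpotentProduct.

(* Group words in the letters x_0, x_1, x_2, ... *)
Inductive word : Type :=
  | WVar of nat
  | WOne
  | WMul of word & word
  | WInv of word.

Fixpoint weval (G : groupType) (f : nat -> G) (w : word) : G :=
  match w with
  | WVar i => f i
  | WOne => 1
  | WMul u v => weval f u * weval f v
  | WInv u => (weval f u)^-1
  end.

Definition wcomm (u v : word) : word :=
  WMul (WInv u) (WMul (WInv v) (WMul u v)).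

(* wgamma k c, for c > 0, is the left-normed commutator [x_k, ..., x_(k + c - 1)] *)
Definition wgamma (k c : nat) : word :=
  foldl wcomm (WVar k) [seq WVar j | j <- iota k.+1 c.-1].

Definition wgamma2 (c d : nat) : word := wcomm (wgamma 0 c) (wgamma c d).

Lemma weval_wcomm (G : groupType) (f : nat -> G) u v :
  weval f (wcomm u v) = [~ weval f u, weval f v].
Proof. by []. Qed.

Lemma eq_weval (G : groupType) (f g : nat -> G) v :
  f =1 g -> weval f v = weval g v.
Proof. by move=> fg; elim: v => //= [u -> w ->|u ->]. Qed.

Section Baer.
Variables (V : set word) (F : groupType).

Definition verbal_subgroup : set F :=
  gen [set z | exists2 v, V v & exists f : nat -> F, z = weval f v].

(* [R V^* F]; a letter that does not occur in v contributes the trivial element *)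
Definition baer_denominator (R : set F) : set F :=
  gen [set z | exists v (f : nat -> F) (i : nat) (r : F), [/\ V v, R r &
    z = weval [eta f with i |-> f i * r] v * (weval f v)^-1]].

Lemma weval_conj (f : nat -> F) (g : F) v :
  weval f v ^ g = weval (fun i => f i ^ g) v.
Proof.
elim: v => //= [|u IHu w IHw|u IHu]; first exact: conj1g.
  by rewrite conjMg IHu IHw.
by rewrite conjVg IHu.
Qed.

Lemma baer_denominator_normal (R : set F) :
  normal R -> normal (baer_denominator R).
Proof.
move=> [_ RJ]; apply: gen_normal => _ g [v [f [i [r [Vv Rr ->]]]]].
exists v, (fun j => f j ^ g), i, (r ^ g); split=> //; first exact: RJ.
rewrite conjMg conjVg !weval_conj; congr (_ * _^-1).
by apply: eq_weval => j /=; case: eqP => // _; rewrite conjMg.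
Qed.

Lemma baer_denominator_sub (R : set F) :
  normal R -> baer_denominator R `<=` R `&` verbal_subgroup.
Proof.
move=> nR; have [sR RJ] := nR; apply: gen_sub.
  have [W1 WF] := gen_subgroup
    [set z | exists2 v, V v & exists f : nat -> F, z = weval f v].
  case: sR => R1 RF; split=> // x y [Rx Wx] [Ry Wy].
  by split; [apply: RF | apply: WF].
move=> _ [v [f [i [r [Vv Rr ->]]]]]; split; last first.
  case: (gen_subgroup
    [set z | exists2 v, V v & exists f : nat -> F, z = weval f v]) => _; apply;
    by apply: sub_gen; exists v => //; eexists.
set f' := [eta f with i |-> f i * r].
have Rf j : R ((f' j)^-1 * f j).
  rewrite /f' /=; case: eqP => [->|_]; last by rewrite mulVg; case: sR.
  by rewrite invgM -mulgA mulVg mulg1; apply: subgroupV.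
have eqf u : weval (fun j => quot_proj nR (f j)) u = quot_proj nR (weval f u).
  by elim: u => [j||u /= -> w ->|u /= ->] //=; rewrite ?gmulf1 ?gmulfM ?gmulfV.
have eqf' u : weval (fun j => quot_proj nR (f' j)) u = quot_proj nR (weval f' u).
  by elim: u => [j||u /= -> w ->|u /= ->] //=; rewrite ?gmulf1 ?gmulfM ?gmulfV.
have E : quot_proj nR (weval f v) = quot_proj nR (weval f' v).
  by rewrite -eqf -eqf'; apply: eq_weval => j; apply/esym/quot_projP.
move/quot_projP: E => /(RJ _ (weval f v)^-1).
by rewrite /conjg invgK !mulgA mulgV mul1g.
Qed.

End Baer.

Arguments verbal_subgroup : clear implicits.

(* The Baer invariant of G with respect to the variety defined by V, computed
   from the presentation pi : F -> G with F free, as a subgroup of F / [R V^* F],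
   where R is the kernel of pi *)
Definition baer_invariant (V : set word) (F G : groupType) (pi : grhom F G) :
    set (quotg (baer_denominator_normal V (kernel_normal pi))) :=
  quot_proj (baer_denominator_normal V (kernel_normal pi)) @`
    (kernel pi `&` verbal_subgroup V F).

Arguments baer_invariant V {F G} pi _.

(* Formal commutators: weight and order depend on the bracketing, not only on the
   value in the free group. *)
Inductive fcomm (m : nat) : Type :=
  | Letter of 'I_m
  | Bracket of fcomm m & fcomm m.
Arguments Letter {m}.
Arguments Bracket {m}.

Section FormalCommutators.
Variable m : nat.

Fixpoint fcomm_encode (t : fcomm m) : GenTree.tree 'I_m :=
  match t with
  | Letter i => GenTree.Leaf i
  | Bracket b a => GenTree.Node 0 [:: fcomm_encode b; fcomm_encode a]
  end.

Fixpoint fcomm_decode (t : GenTree.tree 'I_m) : option (fcomm m) :=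
  match t with
  | GenTree.Leaf i => Some (Letter i)
  | GenTree.Node _ [:: b; a] =>
      if (fcomm_decode b, fcomm_decode a) is (Some b', Some a')
      then Some (Bracket b' a') else None
  | _ => None
  end.

Lemma fcomm_encodeK : pcancel fcomm_encode fcomm_decode.
Proof. by elim=> //= b -> a ->. Qed.

HB.instance Definition _ := Countable.copy (fcomm m) (pcan_type fcomm_encodeK).

Fixpoint wt (t : fcomm m) : nat :=
  match t with
  | Letter _ => 1%N
  | Bracket b a => (wt b + wt a)%N
  end.

Fixpoint fcomm_lt (s t : fcomm m) : bool :=
  (wt s < wt t)%N || ((wt s == wt t) &&
    match s, t with
    | Letter i, Letter j => (i < j)%N
    | Bracket b1 a1, Bracket b2 a2 =>
        fcomm_lt b1 b2 || ((b1 == b2) && fcomm_lt a1 a2)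
    | _, _ => false
    end).

Definition fcomm_le (s t : fcomm m) : bool := (s == t) || fcomm_lt s t.

Fixpoint basic (t : fcomm m) : bool :=
  match t with
  | Letter _ => true
  | Bracket b a =>
      [&& basic b, basic a, fcomm_lt a b &
          if b is Bracket _ b2 then fcomm_le b2 a else true]
  end.

Fixpoint ceval (F : groupType) (x : 'I_m -> F) (t : fcomm m) : F :=
  match t with
  | Letter i => x i
  | Bracket b a => [~ ceval x b, ceval x a]
  end.

Definition commsA (n c1 c2 : nat) : set (fcomm m) :=
  [set t | exists beta alpha : fcomm m, t = Bracket beta alpha /\
    [/\ basic beta, basic alpha, fcomm_lt alpha beta,
        (c1 + 1 <= wt beta <= c1 + n)%N & (c2 + 1 <= wt alpha <= c2 + n)%N]].

Definition commsC (n c1 c2 : nat) : set (fcomm m) :=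
  [set t | exists beta alpha : fcomm m, t = Bracket beta alpha /\
    [/\ basic beta, basic alpha, fcomm_lt alpha beta,
        (c2 + n + 1 <= wt beta)%N /\ (c1 + 1 <= wt alpha)%N
      & (wt beta + wt alpha <= 2 * n + c1 + c2 + 1)%N]].

End FormalCommutators.

Arguments commsA : clear implicits.
Arguments commsC : clear implicits.

(* Main.v *)
From HB Require Import structures.
Require Import Defs.
From mathcomp Require Import all_boot all_order all_algebra.
From mathcomp Require Import boolp classical_sets functions.
From mathcomp Require Import zify.

(** Write p = c1 + 1, q = c2 + 1, and gamma_k for lcs F k. The hypothesis on the
    parameters amounts to 2 n + p <= 2 q. Multilinearity of commutators modulo
    deeper terms of the lower central series identifies V(F) with
    [gamma_p, gamma_q] and the denominator of the Baer invariant with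
    N = [gamma_(p+n), gamma_q] [gamma_(q+n), gamma_p]
    (verbal_wgamma2, baer_denominator_wgamma2), so everything takes place in
    the abelian group [gamma_p, gamma_q] / N.

    It is spanned by the brackets [beta, alpha] of basic commutators, because
    gamma_q modulo gamma_(q+n) is generated by basic commutators
    (lcs_sub_layer) and the bracket is bilinear modulo N. Discarding brackets
    that fall into N leaves exactly those of A - C (bracket_basis_span).

    Independence rests on a numerical coincidence: the weights of beta and alpha
    are so close that the right component of beta has weight below q, hence
    [beta, alpha] is itself a basic commutator (basic_Bracket). With
    K = p + q + 2 n - 1, the group gamma_(p+q) / gamma_K is free abelian on the
    basic commutators of weights p + q, ..., K - 1; modulo gamma_K, the subgroup N is
    generated by basic commutators too, none of which lies in A - C. So
    the coordinate function attached to an element of A - C vanishes on N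
    (bracket_basis_dual), and these functions form a dual family
    (free_abelian_criterion).

    The core is therefore the theorem of Hall and Magnus on basic commutators, in two
    halves. Generation is the usual induction with the Jacobi identity in the
    form of the Hall-Witt identity (commg_basic). For independence, a family of
    additive operators u_i on an abelian group M defines a representation of F
    on power series with coefficients in M by x_i |-> 1 + T u_i; the leading term
    of the image of a commutator is the corresponding Lie bracket of the
    operators (leadR). It remains to find operators whose Lie brackets along the
    basic commutators of weight w can be told apart, and this is done by Lazard
    elimination (separated0): letting the smallest letter act as a derivation and
    the other letters as operators of multiplication turns the brackets over one
    alphabet into brackets over the alphabet obtained by eliminating this
    letter; once all basic commutators of weight less than w are eliminated, those of
    weight w are letters, whose operators are at our disposal. *)

Import GRing.Theory.

Set Implicit Arguments.
Unset Strict Implicit.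
Unset Printing Implicit Defensive.

Local Open Scope classical_set_scope.
Local Open Scope group_scope.

(** * Commutators and the lower central series *)
Section CommutatorCalculus.
Variable G : groupType.
Implicit Types (A B H N S : set G) (x y z g : G).

Lemma normal_subgroup N : normal N -> subgroup N.
Proof. by case. Qed.

Lemma normalJ N x g : normal N -> N x -> N (x ^ g).
Proof. by case=> _; apply. Qed.

Lemma normalRl N x y : normal N -> N x -> N [~ x, y].
Proof.
move=> nN Nx; rewrite commgEl; apply: subgroupM; first exact: normal_subgroup.
  by apply: subgroupV => //; apply: normal_subgroup.
exact: normalJ.
Qed.

Lemma subgroupR_sym S x y : subgroup S -> S [~ x, y] -> S [~ y, x].
Proof. by move=> sS Sxy; rewrite -invgR; apply: subgroupV. Qed.

Lemma commMg x y z : [~ x * y, z] = [~ x, z] ^ y * [~ y, z].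
Proof. by rewrite /commg /conjg !invgM !mulgA !(mulgK, mulgVK). Qed.

Lemma commVg x y : [~ x^-1, y] = ([~ x, y] ^ x^-1)^-1.
Proof. by rewrite /commg /conjg !invgM !invgK !mulgA !(mulgK, mulgVK, mulgV, mul1g). Qed.

Lemma commVV x y : [~ x^-1, y^-1] = [~ x, y] ^ (x * y)^-1.
Proof. by rewrite /commg /conjg !invgM !invgK !mulgA !(mulgK, mulgVK, mulgV, mul1g). Qed.

Lemma Hall_Witt x y z :
  [~ x, y^-1, z] ^ y * [~ y, z^-1, x] ^ z * [~ z, x^-1, y] ^ x = 1.
Proof.
by rewrite /commg /conjg !invgM !invgK !mulgA
  !(mulgK, mulgVK, mulgV, mulVg, mul1g, mulg1).
Qed.

(** Since [xy, z] = [x, z]^y [y, z], bracketing is multiplicative up to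
    conjugation. The target S is only asked to be stable under the subgroup H in
    which the arguments live: the subgroups S of interest are spanned by given brackets
    modulo N, or are kernels of functionals, and are not known to be normal. *)
Lemma commg_closed H B S :
    subgroup H -> subgroup S -> (forall s h, S s -> H h -> S (s ^ h)) ->
  subgroup [set x | H x /\ forall y, B y -> S [~ x, y]].
Proof.
move=> sH sS SJ; split.
  by split; [apply: subgroup1 | move=> y _; rewrite comm1g; apply: subgroup1].
move=> x y [Hx Sx] [Hy Sy]; have HVy := subgroupV sH Hy.
split=> [|z Bz]; first exact: subgroupM.
rewrite commMg commVg; apply: subgroupM => //.
  by apply: SJ => //; apply: Sx.
by apply: subgroupV => //; apply: SJ => //; apply: Sy.
Qed.

Lemma commg_gen H S A B :
    subgroup H -> subgroup S -> (forall s h, S s -> H h -> S (s ^ h)) ->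
    A `<=` H -> B `<=` H -> (forall a b, A a -> B b -> S [~ a, b]) ->
  forall x y, gen A x -> gen B y -> S [~ x, y].
Proof.
move=> sH sS SJ AH BH SAB x y Ax By.
have AS a b : gen A a -> B b -> S [~ a, b].
  move=> Aa Bb; have/= := gen_sub (@commg_closed H B S sH sS SJ) _ Aa.
  case=> [c Ac|_]; last exact.
  by split=> [|d Bd]; [apply: AH | apply: SAB].
apply: subgroupR_sym => //.
have/= := gen_sub (@commg_closed H (gen A) S sH sS SJ) _ By.
case=> [b Bb|_]; last exact.
split=> [|a Aa]; first exact: BH.
by apply: subgroupR_sym => //; apply: AS.
Qed.

Lemma commg_gen_normal S A B :
    normal S -> (forall a b, A a -> B b -> S [~ a, b]) ->
  forall x y, gen A x -> gen B y -> S [~ x, y].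
Proof.
move=> nS; apply: (@commg_gen setT) => //; first exact: normal_subgroup.
by move=> s h Ss _; apply: normalJ.
Qed.

Lemma sub_commg A B a b : A a -> B b -> commg_sub A B [~ a, b].
Proof. by move=> Aa Bb; apply: sub_gen; exists a => //; exists b. Qed.

Lemma commg_sub_le A B S :
  subgroup S -> (forall a b, A a -> B b -> S [~ a, b]) -> commg_sub A B `<=` S.
Proof. by move=> sS SAB; apply: gen_sub => // _ [a Aa [b Bb <-]]; apply: SAB. Qed.

(** The Hall-Witt identity writes one of three nested brackets in terms of
    conjugates of the two others. *)
Lemma three_commg N x y z :
    normal N -> N [~ x, y^-1, z] -> N [~ z, x^-1, y] -> N [~ y, z^-1, x].
Proof.
move=> nN Nx Nz; have sN := normal_subgroup nN.
have : N ([~ y, z^-1, x] ^ z).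
  have E a b c : a * b * c = 1 :> G -> b = a^-1 * c^-1.
    by move=> /mulg1_eq <-; rewrite invgK mulKg.
  rewrite (E _ _ _ (Hall_Witt x y z)).
  by apply: subgroupM => //; apply: subgroupV => //; apply: normalJ.
by move=> /(normalJ z^-1 nN); rewrite conjgK.
Qed.

Lemma commgMr x y z : [~ x, y * z] = [~ x, z] * [~ x, y] ^ z.
Proof. by rewrite /commg /conjg !invgM !mulgA !(mulgK, mulgVK). Qed.

Lemma conjg_mulR x y : x ^ y = x * [~ x, y].
Proof. by rewrite commgEl mulVKg. Qed.

(** Modulo N the factor s is central and t commutes with u and [u, y], so
    neither of them changes the bracket. *)
Lemma commg_congr N u s y t :
    normal N -> (forall a, N [~ s, a]) -> N [~ u, t] -> N [~ [~ u, y], t] ->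
  N ([~ u, y]^-1 * [~ u * s, y * t]).
Proof.
move=> nN Ns Nt Nct; have sN := normal_subgroup nN.
rewrite commMg conjg_mulR [X in X * [~ _, s]]commgMr conjg_mulR.
set c := [~ u, y]; set d := [~ u, y * t].
have -> : c^-1 * ([~ u, t] * (c * [~ c, t]) * [~ d, s] * [~ s, y * t])
    = [~ u, t] ^ c * [~ c, t] * [~ d, s] * [~ s, y * t].
  by rewrite [_ ^ c]/conjg !mulgA.
have Nds : N [~ d, s] by apply: (subgroupR_sym sN).
have Nuc := normalJ c nN Nt.
by apply: (subgroupM sN) (Ns _); apply: (subgroupM sN) Nds; apply: (subgroupM sN).
Qed.

Section LowerCentralSeries.

Lemma lcsSS k : lcs G k.+2 = commg_sub (lcs G k.+1) setT.
Proof. by []. Qed.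

Lemma lcs_subgroup k : subgroup (lcs G k).
Proof. exact/normal_subgroup/lcs_normal. Qed.

Lemma lcs_le i j : (i <= j)%N -> lcs G j `<=` lcs G i.
Proof.
elim: j => [|j IH]; first by case: i.
rewrite leq_eqVlt => /predU1P[->//|/IH ij]; apply: subset_trans ij => x.
case: j {IH} => [//|j]; rewrite lcsSS; move: x; apply: commg_sub_le.
  exact: lcs_subgroup.
by move=> a b La _; apply: normalRl => //; apply: lcs_normal.
Qed.

Lemma lcs_commgT k a b : lcs G k a -> lcs G k.+1 [~ a, b].
Proof. by case: k => [//|k] La; rewrite lcsSS; apply: sub_commg. Qed.

(** Induction on j, where [a, [b, z]] is traded for [[a, z], b] and
    [[a, b], z] by the Hall-Witt identity. *)
Lemma lcs_commg i j a b : lcs G i a -> lcs G j b -> lcs G (i + j) [~ a, b].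
Proof.
elim: j i a b => [|j IH] i a b La.
  by rewrite addn0 => _; apply: normalRl => //; apply: lcs_normal.
case: j IH => [_ _|j IH]; first by rewrite addn1; apply: lcs_commgT.
rewrite lcsSS; have nL := @lcs_normal G (i + j.+2).
have sL := normal_subgroup nL.
have tJ s h : lcs G (i + j.+2) s -> setT h -> lcs G (i + j.+2) (s ^ h).
  by move=> Ls _; apply: normalJ.
have := gen_sub (@commg_closed setT (lcs G i) _ (@setT_normal G).1 sL tJ).
move=> H Lb; apply: subgroupR_sym => //.
suff/H : [set [~ x, y] | x in lcs G j.+1 & y in [set: G]] `<=`
    [set x | [set: G] x /\ (forall y, lcs G i y -> lcs G (i + j.+2) [~ x, y])].
  by move/(_ _ Lb)=> [_]; apply.
move=> _ [x Lx [y _ <-]]; split=> // z Lz; rewrite -[y]invgK.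
have E1 : (i + j.+2 = (i + j.+1).+1)%N by lia.
apply: three_commg => //.
  rewrite E1; apply: lcs_commgT; apply: IH => //.
  by apply: subgroupV => //; apply: lcs_subgroup.
rewrite E1 -addSn; apply: IH => //; apply: subgroupR_sym.
  exact: lcs_subgroup.
by apply: lcs_commgT; apply: subgroupV => //; apply: lcs_subgroup.
Qed.

End LowerCentralSeries.
End CommutatorCalculus.

(** * The order on formal commutators *)
Section FormalOrder.
Variable m : nat.
Implicit Types s t u a b : fcomm m.

Lemma wt_gt0 t : (0 < wt t)%N.
Proof. by elim: t => //= b IHb a _; rewrite addn_gt0 IHb. Qed.

Lemma fcomm_lt_wt s t : fcomm_lt s t -> (wt s <= wt t)%N.
Proof. by case: s t => [i|b a] [j|d c] /orP[/ltnW //|/andP[/eqP E _]]; apply/eq_leq. Qed.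

Lemma wt_fcomm_lt s t : (wt s < wt t)%N -> fcomm_lt s t.
Proof. by case: s => [i|b a] /= ->. Qed.

Lemma fcomm_lt_irr t : fcomm_lt t t = false.
Proof.
elim: t => [i|b IHb a IHa]; first by rewrite /= ltnn.
by rewrite /= ltnn eqxx IHb IHa eqxx.
Qed.

Lemma fcomm_lt_trans : transitive (@fcomm_lt m).
Proof.
move=> t s u; elim: t s u => [i|b IHb a IHa] [j|d c] [k|f e] //=;
  rewrite ?ltnn ?eqxx /=; try lia.
move=> /orP[H1|/andP[/eqP E1 H1]] /orP[H2|/andP[/eqP E2 H2]]; try lia.
rewrite E1 E2 eqxx ltnn /=.
case/orP: H1 => [H1|/andP[/eqP-> H1]]; case/orP: H2 => [H2|/andP[/eqP<- H2]].
- by rewrite (IHb _ _ H1 H2).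
- by rewrite H1.
- by rewrite H2.
- by rewrite eqxx (IHa _ _ H1 H2) orbT.
Qed.

Lemma fcomm_lt_total s t : [|| fcomm_lt s t, s == t | fcomm_lt t s].
Proof.
elim: s t => [i|b IHb a IHa] [j|d c] /=.
- by have [h|h|/val_inj->] := ltngtP i j; rewrite ?eqxx ?orbT.
- by have := wt_gt0 c; have := wt_gt0 d; case: ltngtP => //; lia.
- by have := wt_gt0 a; have := wt_gt0 b; case: ltngtP => //=; rewrite ?orbT //; lia.
- case: ltngtP => //=; rewrite ?orbT //= => _.
  have /or3P[->//|/eqP->|->] := IHb d; last by rewrite !orbT.
  by have /or3P[->|/eqP->|->] := IHa c; rewrite ?eqxx ?orbT.
Qed.

(** The recursion builds commutators by depth, which is bounded by the weight;
    the list is only used to know that commutators of bounded weight are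
    finite in number. *)
Fixpoint fcomm_list (n : nat) : seq (fcomm m) :=
  if n is k.+1 then
    [seq Letter i | i <- enum 'I_m] ++
    [seq Bracket b a | b <- fcomm_list k, a <- fcomm_list k]
  else [::].

Lemma mem_fcomm_list n t : (wt t <= n)%N -> t \in fcomm_list n.
Proof.
elim: n t => [|n IH] [i|b a] /=; rewrite ?mem_cat.
- by [].
- by have := wt_gt0 a; lia.
- by move=> _; rewrite map_f // mem_enum.
- have := wt_gt0 a; have := wt_gt0 b => wb wa le_n.
  by apply/orP; right; apply/allpairsP; exists (b, a); split=> //=; apply: IH; lia.
Qed.

(** Among the finitely many commutators of weight at most W there is no infinite
    increasing sequence. *)
Lemma fcomm_lt_ind_down (W : nat) (Q : fcomm m -> Prop) :
    (forall a, (wt a <= W)%N ->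
       (forall b, (wt b <= W)%N -> fcomm_lt a b -> Q b) -> Q a) ->
  forall a, (wt a <= W)%N -> Q a.
Proof.
move=> IH a; pose mu a := count (fcomm_lt a) (fcomm_list W).
move Ek : (mu a).+1 => k; have {Ek}: (mu a < k)%N by rewrite -Ek.
elim: k a => [//|k IHk] a; rewrite ltnS => le_k wa.
apply: IH => // b wb ab; apply: IHk => //; apply: leq_trans le_k.
rewrite /mu; elim: (fcomm_list W) (mem_fcomm_list wb) => //= c s IHs.
have sub : (count (fcomm_lt b) s <= count (fcomm_lt a) s)%N.
  by apply: sub_count => d; apply: fcomm_lt_trans.
rewrite inE => /predU1P[<-|/IHs]; first by rewrite ab fcomm_lt_irr; lia.
have : fcomm_lt b c ==> fcomm_lt a c.
  by apply/implyP => bc; apply: fcomm_lt_trans bc.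
by case: fcomm_lt; case: fcomm_lt => //= _; lia.
Qed.

End FormalOrder.

(** * Basic commutators generate the lower central factors *)
Section Generation.
Variables (m : nat) (F : groupType) (x : 'I_m -> F).
Implicit Types (a b d t : fcomm m).

Definition layer (i j : nat) : set F :=
  [set ceval x t | t in [set t | basic t /\ (i <= wt t < j)%N]] `|` lcs F j.

Local Notation slice k := (gen (layer k k.+1)).

Lemma ceval_lcs t : lcs F (wt t) (ceval x t).
Proof. by elim: t => //= b IHb a IHa; apply: lcs_commg. Qed.

Lemma ceval_lcs_le k t : (k <= wt t)%N -> lcs F k (ceval x t).
Proof. by move=> kt; apply: (lcs_le kt); apply: ceval_lcs. Qed.

Lemma mem_layer i j t :
  basic t -> (i <= wt t < j)%N -> gen (layer i j) (ceval x t).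
Proof. by move=> bt wt; apply: sub_gen; left; exists t. Qed.

Lemma lcs_layer i j : lcs F j `<=` gen (layer i j).
Proof. by apply: subset_trans (@sub_gen _ _) => y Ly; right. Qed.

Lemma layer_sub_lcs i j : (i <= j)%N -> layer i j `<=` lcs F i.
Proof.
move=> ij; move=> y [[t [_ /andP[it _]] <-]|]; first exact: ceval_lcs_le.
exact: lcs_le ij _.
Qed.

(** The subgroup lies between gamma_k and gamma_(k+1), and gamma_k is central
    modulo gamma_(k+1). *)
Lemma slice_normal k : normal (slice k).
Proof.
split=> [|y g Sy]; first exact: gen_subgroup.
have -> : y ^ g = y * [~ y, g] by rewrite commgEl mulVKg.
apply: (subgroupM (gen_subgroup _)) => //.
apply: lcs_layer; apply: lcs_commgT.
by apply: gen_sub Sy; [apply: lcs_subgroup | apply: layer_sub_lcs].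
Qed.

Lemma slice_commg i a y :
    (forall d, basic d -> wt d = i ->
       slice (i + wt a) [~ ceval x d, ceval x a]) ->
  slice i y -> slice (i + wt a) [~ y, ceval x a].
Proof.
move=> Sd Sy; apply: (@commg_gen_normal _ _ (layer i i.+1) [set ceval x a]) => //.
- exact: slice_normal.
- move=> z _ [[d [bd wd] <-]|Lz] ->; first by apply: Sd => //; lia.
  by apply: lcs_layer; rewrite -addSn; apply: lcs_commg => //; apply: ceval_lcs.
- by apply: sub_gen.
Qed.

(** Induction on the total weight W, then downwards on the smaller of the two
    commutators. If b > a and [b, a] is not basic, then b = [b1, b2] with
    a < b2 < b1, and modulo gamma_(W+1) the Jacobi identity gives
    [[b1, b2], a] = [[b1, a], b2] [[b2, a], b1]^-1. By induction on
    the weight, [b1, a] and [b2, a] are products of basic commutators; these are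
    heavier than a, so that both brackets on the right involve only pairs of
    basic commutators larger than a. *)
Lemma commg_basic b a : basic b -> basic a ->
  slice (wt b + wt a) [~ ceval x b, ceval x a].
Proof.
move EW : (wt b + wt a)%N => W.
elim/ltn_ind: W b a EW => W IHW.
have nW := slice_normal W; have sW := normal_subgroup nW.
suff main a : (wt a <= W)%N -> basic a -> forall b, basic b -> fcomm_lt a b ->
    (wt b + wt a)%N = W -> slice W [~ ceval x b, ceval x a].
  move=> b a EW bb ba; have /or3P[lt_ba|/eqP->|lt_ab] := fcomm_lt_total b a.
  - by apply: (subgroupR_sym sW); apply: main => //; lia.
  - by rewrite commgg; exact: (subgroup1 sW).
  - by apply: main => //; lia.
move: a; apply: fcomm_lt_ind_down => a wa IHa ba b bb lt_ab EW.
have pair d e : basic d -> basic e -> fcomm_lt a d -> fcomm_lt a e ->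
    (wt d + wt e)%N = W -> slice W [~ ceval x d, ceval x e].
  move=> bd be ad ae Ede; have /or3P[lt_de|/eqP->|lt_ed] := fcomm_lt_total d e.
  - by apply: (subgroupR_sym sW); apply: IHa => //; lia.
  - by rewrite commgg; exact: (subgroup1 sW).
  - by apply: IHa => //; lia.
have [bba|nbba] := boolP (basic (Bracket b a)).
  by apply: (mem_layer bba); rewrite /= EW leqnn ltnSn.
case: b bb lt_ab EW nbba => [i|b1 b2] bb lt_ab EW; first by rewrite /= ba lt_ab.
rewrite [basic _]/= -[X in X && _]/(basic (Bracket b1 b2)) bb ba lt_ab /=.
rewrite /fcomm_le negb_or => /andP[ne_b2a nlt_b2a].
have lt_ab2 : fcomm_lt a b2.
  by have := fcomm_lt_total b2 a; rewrite (negPf ne_b2a) (negPf nlt_b2a).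
case/and4P: bb => bb1 bb2 lt_b21 _.
have lt_ab1 := fcomm_lt_trans lt_ab2 lt_b21.
have w1 := wt_gt0 b1; have w2 := wt_gt0 b2; have wa0 := wt_gt0 a.
rewrite /= in EW.
have S1 : slice (wt b1 + wt a) [~ ceval x b1, ceval x a].
  by apply: IHW => //; lia.
have S2 : slice (wt b2 + wt a) [~ ceval x b2, ceval x a].
  by apply: IHW => //; lia.
(* b2 = (b2^-1)^-1 brings the bracket to the shape of the Hall-Witt identity *)
rewrite /= -[X in [~ _, X, _]]invgK; apply: (three_commg nW).
- apply: (subgroupR_sym sW); rewrite commVg -conjVg; apply: (normalJ _ nW).
  rewrite invgR -EW.
  rewrite addnAC; apply: slice_commg => [d bd wd|].
    rewrite addnAC EW; apply: pair => //; last by rewrite wd addnAC.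
    by apply: wt_fcomm_lt; rewrite wd -[X in (X < _)%N]add0n ltn_add2r.
  apply: (subgroupR_sym (gen_subgroup _)).
  rewrite commVg -conjVg; apply: (normalJ _ (slice_normal _)).
  by apply: (subgroupV (gen_subgroup _)).
- rewrite -EW.
  rewrite -addnA addnC; apply: slice_commg => [d bd wd|].
    rewrite addnC addnA EW; apply: pair => //; last by rewrite wd addnC addnA.
    by apply: wt_fcomm_lt; rewrite wd -[X in (X < _)%N]add0n ltn_add2r.
  rewrite commVV; exact: (normalJ _ (slice_normal _)).
Qed.

Hypothesis genx : forall S, subgroup S -> (forall i, S (x i)) -> forall y, S y.

Lemma lcs_sub_slice k : (0 < k)%N -> lcs F k `<=` slice k.
Proof.
case: k => // k _; elim: k => [|k IHk].
  move=> y _; apply: genx => [|i]; first exact: gen_subgroup.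
  exact: (mem_layer (t := Letter i)).
rewrite lcsSS; apply: commg_sub_le; first exact: gen_subgroup.
move=> y z /IHk Sy _.
suff : gen (range x) z.
  apply: (@commg_gen_normal _ _ (layer k.+1 k.+2)) Sy => //.
    exact: slice_normal.
  move=> s _ Ss [i _ <-]; rewrite -[k.+2]addn1.
  apply: (slice_commg (a := Letter i)); last exact: sub_gen.
  by move=> d bd <-; apply: (commg_basic (a := Letter i)).
apply: genx => [|i]; first exact: gen_subgroup.
by apply: sub_gen; exists i.
Qed.

Lemma lcs_sub_layer i j : (0 < i <= j)%N -> lcs F i `<=` gen (layer i j).
Proof.
case/andP=> i0; elim: j => [|j IHj]; first by rewrite leqn0 => /eqP->; apply: lcs_layer.
rewrite leq_eqVlt => /predU1P[->|ij]; first exact: lcs_layer.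
apply: subset_trans (IHj ij) _; apply: gen_sub; first exact: gen_subgroup.
move=> u [[t [bt /andP[it tj]] <-]|/lcs_sub_slice Ly].
  by apply: mem_layer => //; lia.
move: (Ly (leq_trans i0 ij)); apply: gen_sub; first exact: gen_subgroup.
move=> v [[t [bt /andP[jt tj]] <-]|]; last exact: lcs_layer.
by apply: mem_layer => //; lia.
Qed.

End Generation.

(** * Unipotent automorphisms of power series and their leading terms *)
Section AdditiveAutomorphisms.
Variable V : zmodType.

(** The inverse is part of the data, so that no choice is needed to invert;
    automorphisms act on the right, the product being composition in diagram order. *)
Record addaut : Type := AddAut {
  aut_fun :> V -> V;
  aut_inv : V -> V;
  autK : cancel aut_fun aut_inv;
  autVK : cancel aut_inv aut_fun;
  autD : {morph aut_fun : f g / (f + g)%R}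
}.

Implicit Types g h : addaut.

Lemma addautP g h : g =1 h -> g = h.
Proof.
case: g h => [f f' K VK D] [e e' K' VK' D'] /= /funext fe; subst e.
have/funext fe' : f' =1 e' by move=> v; rewrite -{1}(VK' v) K.
by subst e'; congr AddAut; apply: Prop_irrelevance.
Qed.

Lemma autN g : {morph g : v / (- v)%R}.
Proof.
move=> v; apply/eqP; rewrite -addr_eq0 -autD addNr.
by rewrite -(inj_eq (addrI (g 0%R))) -autD !addr0.
Qed.

Lemma aut_invD g : {morph aut_inv g : v w / (v + w)%R}.
Proof. by move=> v w; apply: (can_inj (autK g)); rewrite autD !autVK. Qed.

HB.instance Definition _ := gen_eqMixin addaut.
HB.instance Definition _ := gen_choiceMixin addaut.

Definition addaut_one : addaut :=
  @AddAut id id (fun=> erefl) (fun=> erefl) (fun _ _ => erefl).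

Definition addaut_inv g : addaut := AddAut (autVK g) (autK g) (@aut_invD g).

Lemma addaut_mulD g h : {morph h \o g : v w / (v + w)%R}.
Proof. by move=> v w /=; rewrite !autD. Qed.

Definition addaut_mul g h : addaut :=
  AddAut (can_comp (autK h) (autK g)) (can_comp (autVK g) (autVK h))
         (addaut_mulD g h).

Lemma addaut_mulA : associative addaut_mul.
Proof. by move=> f g h; apply: addautP. Qed.

Lemma addaut_mul1 : left_id addaut_one addaut_mul.
Proof. by move=> g; apply: addautP. Qed.

Lemma addaut_1mul : right_id addaut_one addaut_mul.
Proof. by move=> g; apply: addautP. Qed.

Lemma addaut_mulV : left_inverse addaut_one addaut_inv addaut_mul.
Proof. by move=> g; apply: addautP => v /=; rewrite autVK. Qed.

Lemma addaut_Vmul : right_inverse addaut_one addaut_inv addaut_mul.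
Proof. by move=> g; apply: addautP => v /=; rewrite autK. Qed.

HB.instance Definition _ := isGroup.Build addaut
  addaut_mulA addaut_mul1 addaut_1mul addaut_mulV addaut_Vmul.

Lemma addautM g h v : (g * h) v = h (g v).
Proof. by []. Qed.

End AdditiveAutomorphisms.

Section LeadingTerms.
Local Open Scope ring_scope.
Variable M : zmodType.
Local Notation series := (nat -> M).
Implicit Types (f : series) (g h : addaut series) (L : M -> M).

(** A function nat -> M is seen as a power series in T with coefficients in M;
    lead k g L means g = 1 + T^k L + (higher order), tested on the series
    divisible by T^j for every j. Stating it this way spares any T-linearity
    requirement on g. *)
Definition lead (k : nat) g L : Prop :=
  forall j f, (forall i, (i < j)%N -> f i = 0) ->
    (forall i, (i < j + k)%N -> g f i = f i) /\ g f (j + k)%N = f (j + k)%N + L (f j).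

Lemma lead1 k : lead k 1%g (fun=> 0).
Proof. by move=> j f f0; split=> //; rewrite addr0. Qed.

Lemma leadM k g h L L' : (0 < k)%N ->
  lead k g L -> lead k h L' -> lead k (g * h)%g (fun v => L v + L' v).
Proof.
move=> k0 lg lh j f f0; have [g1 g2] := lg j f f0; rewrite !addautM.
have [i ij|h1 h2] := lh j (g f); first by rewrite g1 ?f0 //; lia.
split=> [i ij|]; first by rewrite h1 ?g1.
by rewrite h2 g2 g1 ?addrA //; lia.
Qed.

Lemma leadV k g L : (0 < k)%N -> lead k g L -> lead k (g^-1)%g (fun v => - L v).
Proof.
move=> k0 lg j f f0; set f' := (g^-1)%g f.
have gf' : g f' = f by apply: autVK.
have f'0 i : (i < j)%N -> f' i = 0.
  elim/ltn_ind: i => i IH ij.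
  have [l li|g1 _] := lg i f'; first by apply: IH => //; apply: ltn_trans ij.
  by rewrite -g1 ?gf' ?f0 //; lia.
have [g1 g2] := lg j f' f'0; rewrite gf' in g1 g2.
split=> [i ij|]; first by rewrite g1.
by rewrite g2 g1 ?addrK //; lia.
Qed.

Lemma seriesD f f' i : (f + f') i = f i + f' i.
Proof. by []. Qed.

Lemma seriesB f f' i : (f - f') i = f i - f' i.
Proof. by []. Qed.

Lemma lead_comp k l g h L L' j f : lead k g L -> lead l h L' ->
    (forall i, (i < j)%N -> f i = 0) ->
  exists e : series, [/\ forall i, (i < j + (k + l))%N -> e i = 0,
    e (j + (k + l))%N = L' (L (f j)) & h (g f) = g f + h f - f + e].
Proof.
move=> lg lh f0; have [d0 d1] := lg j f f0.
have [|e0 e1] := lh (j + k)%N (g f - f).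
  by move=> i ij; rewrite seriesB d0 // subrr.
exists (h (g f - f) - (g f - f)); split.
- by move=> i ij; rewrite seriesB e0 ?subrr // -addnA.
- by rewrite addnA !seriesB e1 !seriesB d1 [X in L' X]addrC addKr addrC addKr.
- rewrite autD autN addrC [g f + h f - f]addrAC addrA.
  by rewrite -[_ - (g f - f) + _]addrA addrA subrK subrK.
Qed.

Lemma lead_low k g L j f : (0 < k)%N -> lead k g L ->
  (forall i, (i < j)%N -> f i = 0) -> forall i, (i <= j)%N -> g f i = f i.
Proof. by move=> k0 lg f0 i ij; apply: (lg j f f0).1; lia. Qed.

(** Both g h and h g have the form 1 + T^k L + T^l L' + ... , and they first
    differ in degree k + l, by the commutator of the leading operators; its sign
    reflects that automorphisms act on the right. *)
Lemma leadR k l g h L L' : (0 < k)%N -> (0 < l)%N ->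
  lead k g L -> lead l h L' ->
  lead (k + l) [~ g, h] (fun v => L' (L v) - L (L' v)).
Proof.
move=> k0 l0 lg lh j f' f'0; pose f1 := (g^-1)%g f'; pose f := (h^-1)%g f1.
have f1E := lead_low k0 (leadV k0 lg) f'0.
have f10 i : (i < j)%N -> f1 i = 0 by move=> ij; rewrite /f1 f1E ?f'0 // ltnW.
have fE := lead_low l0 (leadV l0 lh) f10.
have f0 i : (i < j)%N -> f i = 0 by move=> ij; rewrite /f fE ?f10 // ltnW.
have fj : f j = f' j by rewrite /f fE // /f1 f1E.
have hgf : g (h f) = f' by rewrite /f /f1 !autVK.
have -> : [~ g, h] f' = h (g f).
  by rewrite -[RHS]/((g * h)%g f) commgC !addautM hgf.
have [e [e0 e1 ->]] := lead_comp lg lh f0.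
have [d [d0 d1]] := lead_comp lh lg f0.
rewrite (addnC l k) in d0 d1; rewrite [h f + _]addrC hgf => f'E.
have hgE : g f + h f - f = f' - d by rewrite f'E addrK.
rewrite {}hgE; split=> [i ij|].
  by rewrite seriesD seriesB e0 // d0 // subr0 addr0.
by rewrite seriesD seriesB e1 d1 fj -addrA [- _ + _]addrC.
Qed.

Definition degree0 (v : M) : series := fun i => if i == 0%N then v else 0.

Lemma lead_degree0 k g L v : (0 < k)%N -> lead k g L -> g (degree0 v) k = L v.
Proof.
by case: k => // k _ /(_ 0%N (degree0 v)) [//|_]; rewrite add0n add0r.
Qed.

Lemma lead_degree0S k g L v : (0 < k)%N -> lead k.+1 g L -> g (degree0 v) k = 0.
Proof.
by case: k => // k _ /(_ 0%N (degree0 v)) [//|/(_ k.+1) -> //].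
Qed.

Section Unipotent.
Variables (u : M -> M) (uD : {morph u : v w / v + w}).

(** Multiplication by 1 + T u; its inverse is found degree by degree. *)
Definition unip_fun f : series :=
  fun i => if i is i'.+1 then f i + u (f i') else f i.

Fixpoint unip_inv f (i : nat) : M :=
  if i is i'.+1 then f i - u (unip_inv f i') else f i.

Lemma unip_funK : cancel unip_fun unip_inv.
Proof.
by move=> f; apply/funext; elim=> //= i ->; rewrite addrK.
Qed.

Lemma unip_invK : cancel unip_inv unip_fun.
Proof. by move=> f; apply/funext; case=> //= i; rewrite subrK. Qed.

Lemma unip_funD : {morph unip_fun : f f' / f + f'}.
Proof.
move=> f f'; apply/funext; case=> [//|i] /=.
by rewrite !seriesD /= uD addrACA.
Qed.

Definition unip : addaut series := AddAut unip_funK unip_invK unip_funD.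

Lemma lead_unip : lead 1 unip u.
Proof.
move=> j f f0; split=> [[|i]|]; rewrite ?addn1 //=.
move=> ij.
have u0 : u 0 = 0 by apply: (addrI (u 0)); rewrite -uD !addr0.
by rewrite (f0 i) ?u0 ?addr0.
Qed.

End Unipotent.
End LeadingTerms.

(** * Lazard elimination *)
Section Elimination.
Local Open Scope ring_scope.
Variable m : nat.
Implicit Types (a b c d t : fcomm m) (E : pred (fcomm m)).

(** The commutators with right component in E count as new letters, with an
    operator of their own; all other brackets are expanded. When E consists of
    the basic commutators below a, the basic commutators not in E are the
    iterated brackets of the alphabet left after eliminating E. *)
Fixpoint lie_op E (M : zmodType) (u : fcomm m -> M -> M) t : M -> M :=
  match t with
  | Letter _ => u t
  | Bracket b a =>
      if E a then u t else fun v =>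
        lie_op E u a (lie_op E u b v) - lie_op E u b (lie_op E u a v)
  end.

(** Over the alphabet left after eliminating E, some choice of operators on
    the letters and some matrix coefficient of operators
    distinguish t0 from the other basic commutators of its weight. *)
Definition separated w t0 E : Prop :=
  exists (M : zmodType) (u : fcomm m -> M -> M) (eps : M -> int) (v0 : M),
    [/\ forall t, {morph u t : v v' / v + v'}, {morph eps : v v' / v + v'}
      & forall t, basic t -> wt t = w -> eps (lie_op E u t v0) = (t == t0)%:R].

(** Once everything lighter is eliminated, the basic commutators of weight w are
    letters: t0 acts as the identity of the integers and the others by 0. *)
Lemma separated_all w t0 E :
  (forall d, basic d -> (wt d < w)%N -> E d) -> separated w t0 E.
Proof.
move=> allE; exists int, (fun t v => if t == t0 then v else 0), id, 1.
split=> // [t v v'|t bt wt_t]; first by case: eqP; rewrite ?addr0.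
have -> : lie_op E (fun t v => if t == t0 then v else 0) t
        = (fun v : int => if t == t0 then v else 0).
  case: t bt wt_t => [//|b a] /and4P[_ ba _ _] /= wE.
  by rewrite allE //; have := wt_gt0 b; lia.
by case: eqP.
Qed.

Section Step.
Variables (M : zmodType) (u : fcomm m -> M -> M).
Hypothesis uD : forall t, {morph u t : v v' / v + v'}.

Definition shift (T : Type) (f : nat -> T) : nat -> T := fun i => f i.+1.

(** Sequences form the cofree module with a derivation, the shift. The operator
    of multiplication by a sequence Y of operators is determined by its
    degree 0 part and by the Leibniz rule D (Y f) = Y (D f) + (D Y) f, which is
    taken as its definition. *)
Fixpoint leibniz (Y : nat -> M -> M) (f : nat -> M) (i : nat) : M :=
  if i is j.+1 then leibniz Y (shift f) j + leibniz (shift Y) f j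
  else Y 0%N (f 0%N).

Lemma leibnizD (Y : nat -> M -> M) :
  (forall j, {morph Y j : v v' / v + v'}) -> {morph leibniz Y : f f' / f + f'}.
Proof.
move=> YD f f'; apply/funext => i; rewrite seriesD.
elim: i Y YD f f' => [|i IH] Y YD f f' /=; first by rewrite seriesD YD.
rewrite -[shift (f + f')]/(shift f + shift f') !IH // => [|j]; last exact: YD.
by rewrite addrACA.
Qed.

(** The letters created by the elimination of a are the [c, a, ..., a]. *)
Definition ad_right a (j : nat) c := iter j (fun b => Bracket b a) c.

(** The letter a becomes the derivation and c the multiplication by the sequence
    of the operators of c, [c, a], [c, a, a], ..., so that bracketing with a
    shifts this sequence. *)
Definition elim_op a c : (nat -> M) -> (nat -> M) :=
  if c == a then @shift M else leibniz (fun j => u (ad_right a j c)).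

Lemma elim_opD a c : {morph elim_op a c : f f' / f + f'}.
Proof.
by move=> f f'; rewrite /elim_op; case: eqP => // _; apply: leibnizD => j; apply: uD.
Qed.

Variables (a : fcomm m) (E E' : pred (fcomm m)).
Hypothesis ba : basic a.
Hypothesis Elt : forall d, basic d -> E d = fcomm_lt d a.
Hypothesis E'E : forall d, E' d = (d == a) || E d.

Lemma lie_op_eliminated : lie_op E (elim_op a) a = @shift M.
Proof.
have ea : elim_op a a = @shift M by rewrite /elim_op eqxx.
case: a ba Elt ea => [//|b d] /and4P[_ bd _ _] Ed.
by rewrite /= Ed // wt_fcomm_lt //=; have := wt_gt0 b; lia.
Qed.

(** On the letters [b, a, ..., a] of the new alphabet the operators are
    multiplications, by the Leibniz rule; multiplications act in degree 0
    through the degree 0 term of the sequence alone, and this property is inherited by brackets.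
    The induction needs both statements together because b must be a letter
    before [b, a] can be treated. *)
Lemma lie_op_elim c : basic c -> fcomm_lt a c ->
  (forall f, lie_op E (elim_op a) c f 0%N = lie_op E' u c (f 0%N)) /\
  ((if c is Bracket _ d then E' d else true) ->
    lie_op E (elim_op a) c = leibniz (fun j => u (ad_right a j c))).
Proof.
elim: c => [i|b IHb d IHd] bc lt_ac.
  have ne : (Letter i == a) = false.
    by apply: contraTF lt_ac => /eqP->; rewrite fcomm_lt_irr.
  by rewrite /= /elim_op ne.
have ne : (Bracket b d == a) = false.
  by apply: contraTF lt_ac => /eqP->; rewrite fcomm_lt_irr.
case/and4P: (bc) => bb bd lt_db bb2; rewrite [lie_op _ _ _]/= [lie_op E' _ _]/= E'E.
have [Ed|nEd] := boolP (E d); first by rewrite orbT /elim_op ne.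
rewrite orbF; have := nEd; rewrite Elt // => nlt_da.
case: eqP => [eda|/eqP ne_da]; last first.
  have lt_ad : fcomm_lt a d.
    by have := fcomm_lt_total d a; rewrite (negPf nlt_da) (negPf ne_da).
  have lt_ab := fcomm_lt_trans lt_ad lt_db.
  have [IHb1 _] := IHb bb lt_ab; have [IHd1 _] := IHd bd lt_ad.
  by split=> // f; rewrite seriesB !IHb1 !IHd1 !IHb1.
have lt_ab : fcomm_lt a b by rewrite -eda.
have [_ IHb2] := IHb bb lt_ab.
suff EL : (fun v => lie_op E (elim_op a) d (lie_op E (elim_op a) b v) -
     lie_op E (elim_op a) b (lie_op E (elim_op a) d v))
   = leibniz (fun j => u (ad_right a j (Bracket b d))).
  by split=> // f; have := congr1 (fun g => g f 0%N) EL.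
(* c = [b, a], and b is a letter since c is basic *)
rewrite eda lie_op_eliminated IHb2; last first.
  case: b bb bb2 {IHb bc lt_ac ne lt_db lt_ab IHb2} => // b1 b2 /and4P[_ bb2 _ _].
  by rewrite /fcomm_le E'E eda Elt.
apply/funext => f; apply/funext => i; rewrite seriesB /= [shift _ i]/=.
rewrite /shift /= [X in X - _]addrC addrK.
congr (leibniz _ _ _); apply/funext => j.
by rewrite /ad_right -iterSr.
Qed.

End Step.

(** The coefficient is read off in degree 0, on series starting with v0. *)
Lemma separated_step w t0 a E E' : basic a -> (wt a < w)%N ->
    (forall d, basic d -> E d = fcomm_lt d a) ->
    (forall d, E' d = (d == a) || E d) ->
  separated w t0 E' -> separated w t0 E.
Proof.
move=> ba wa Elt E'E [M [u [eps [v0 [uD epsD sep]]]]].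
exists (nat -> M), (elim_op u a), (fun f => eps (f 0%N)), (degree0 v0).
split=> [t|f f'|t bt wt_t]; first exact: elim_opD.
  by rewrite seriesD epsD.
have lt_at : fcomm_lt a t by apply: wt_fcomm_lt; rewrite wt_t.
have [-> _] := lie_op_elim u ba Elt E'E bt lt_at.
exact: sep.
Qed.

(** The basic commutators of weight less than w are eliminated in increasing
    order; the argument runs backwards, from the situation where all of them are
    eliminated. *)
Lemma separated0 w t0 : separated w t0 pred0.
Proof.
pose L := sort (@fcomm_le m) [seq t <- undup (fcomm_list m w) | basic t && (wt t < w)%N].
have memL d : (d \in L) = basic d && (wt d < w)%N.
  rewrite mem_sort mem_filter mem_undup andb_idr // => /andP[_ wd].
  by apply: mem_fcomm_list; apply: ltnW.
have uL : uniq L by rewrite sort_uniq filter_uniq ?undup_uniq.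
have leT : transitive (@fcomm_le m).
  move=> b a c /predU1P[->//|ab] /predU1P[<-|bc]; apply/predU1P; right=> //.
  exact: fcomm_lt_trans bc.
have leA s t : fcomm_le s t || fcomm_le t s.
  rewrite /fcomm_le; have /or3P[->|->|->] := fcomm_lt_total s t; by rewrite ?orbT.
have pL : pairwise (@fcomm_le m) L.
  by rewrite -sorted_pairwise //; apply: sort_sorted.
suff main s2 s1 : L = s1 ++ s2 -> separated w t0 (mem s1).
  by have := main L [::] erefl.
elim: s2 s1 => [|a s2 IH] s1 EL.
  by rewrite cats0 in EL; apply: separated_all => d bd wd; rewrite /= -EL memL bd.
have /andP[ba wa] : basic a && (wt a < w)%N by rewrite -memL EL mem_cat mem_head orbT.
apply: (separated_step ba wa) (IH (rcons s1 a) _); last by rewrite cat_rcons.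
  move=> d bd /=; move: pL uL; rewrite EL pairwise_cat cat_uniq /=.
  case/and3P=> /allrelP le12 _ /andP[/allP lea _] /and3P[_ /norP[na _] /andP[na2 _]].
  apply/idP/idP=> [ds1|lt_da].
    have /predU1P[eda|//] := le12 d a ds1 (mem_head _ _).
    by rewrite -eda ds1 in na.
  have: d \in L by rewrite memL bd (leq_ltn_trans (fcomm_lt_wt lt_da)).
  rewrite EL mem_cat inE => /or3P[//|/eqP eda|ds2].
    by rewrite eda fcomm_lt_irr in lt_da.
  have /predU1P[ead|lt_ad] := lea d ds2.
    by rewrite -ead fcomm_lt_irr in lt_da.
  by have := fcomm_lt_trans lt_da lt_ad; rewrite fcomm_lt_irr.
by move=> d; rewrite /= mem_rcons inE.
Qed.

End Elimination.

(** * Generators of free groups and integer powers *)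
Section SubgroupType.
Variables (G : groupType) (S : set G) (sS : subgroup S).

Definition in_subgroup : {pred G} := [pred y | `[< S y >]].

Definition subgroup_type of subgroup S : Type := {y : G | y \in in_subgroup}.

Lemma in_subgroup_closed : group_closed in_subgroup.
Proof.
split; first by apply/asboolP; apply: subgroup1.
by move=> y z /asboolP Sy /asboolP Sz; apply/asboolP; apply: sS.2.
Qed.

HB.instance Definition _ := Choice.on (subgroup_type sS).
HB.instance Definition _ := SubChoice.on (subgroup_type sS).
HB.instance Definition _ :=
  SubChoice_isSubGroup.Build G in_subgroup (subgroup_type sS) in_subgroup_closed.

End SubgroupType.

(** The map from F to the subgroup S fixing the letters, followed by the
    inclusion, is the identity by uniqueness. *)
Lemma free_group_gen (I : Type) (F : groupType) (x : I -> F) :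
  is_free_group x ->
  forall S : set F, subgroup S -> (forall i, S (x i)) -> forall y, S y.
Proof.
move=> freeF S sS Sx y.
have Sx' i : x i \in in_subgroup S by apply/asboolP.
have [f [fx _]] := freeF (subgroup_type sS) (fun i => exist _ (x i) (Sx' i)).
have [e [_ eU]] := freeF F x.
have vfE : (fun z => val (f z)) =1 e.
  by apply: (eU (val \o f : grhom F F)) => i; rewrite /= fx.
have idE : id =1 e by apply: (eU (idfun : grhom F F)).
by have /asboolP := valP (f y); rewrite vfE -idE.
Qed.

Section IntegerPowers.
Variable G : groupType.
Implicit Types (y z : G) (i j : int).
Local Open Scope ring_scope.

Lemma zexpgS y i : zexpg y (i + 1) = (zexpg y i * y)%g.
Proof.
case: i => [n|[|n]]; first by rewrite /= addn1 expgSr.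
  by rewrite /= expg1 mulVg.
have -> : Negz n.+1 + 1 = Negz n by lia.
by rewrite /= [in RHS]expgS invgM mulgVK.
Qed.

Lemma zexpgD y i j : zexpg y (i + j) = (zexpg y i * zexpg y j)%g.
Proof.
elim/int_rect: j => [|n IH|n IH]; first by rewrite addr0 mulg1.
  by rewrite -addn1 PoszD addrA zexpgS IH -mulgA -zexpgS.
have E : - n%:Z = - n.+1%:Z + 1 by lia.
apply: (mulIg y); rewrite -mulgA -!zexpgS -addrA -E; exact: IH.
Qed.

Lemma commute_zexpg y z i j : commute y z -> commute (zexpg y i) (zexpg z j).
Proof.
move=> yz; case: i => n; case: j => k /=; rewrite ?expgS;
  by do ?[apply: commuteV | apply: commute_sym; apply: commuteV; apply: commute_sym];
     rewrite -?expgS; apply: commuteX2.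
Qed.

Lemma subgroup_zexpg (S : set G) y i : subgroup S -> S y -> S (zexpg y i).
Proof.
move=> sS Sy; have SX n : S (y ^+ n)%g.
  by elim: n => [|n IH]; [apply: subgroup1 | rewrite expgS; apply: subgroupM].
by case: i => n /=; [|apply: subgroupV].
Qed.

Lemma subgroup_prod (S : set G) (I : eqType) (s : seq I) (E : I -> G) :
  subgroup S -> (forall k, k \in s -> S (E k)) -> S (\prod_(k <- s) E k)%g.
Proof.
move=> sS SE; rewrite big_seq; elim/big_ind: _ => [|y z|k]; first exact: subgroup1.
  exact: subgroupM.
exact: SE.
Qed.

Lemma prod_zexpgD (I : eqType) (s : seq I) (v : I -> G) (k l : I -> int) :
    (forall a b, a \in s -> b \in s -> commute (v a) (v b)) ->
  (\prod_(a <- s) zexpg (v a) (k a + l a)%R =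
   (\prod_(a <- s) zexpg (v a) (k a)) * \prod_(a <- s) zexpg (v a) (l a))%g.
Proof.
move=> vC; rewrite [LHS]big_seq (eq_bigr _ (fun a _ => zexpgD (v a) (k a) (l a))).
rewrite prodgM_commute -?big_seq // => a b sa sb.
by apply: commute_zexpg; apply: vC.
Qed.

Lemma prod_zexpg_delta (I : eqType) (s : seq I) (v : I -> G) (a : I) :
  uniq s -> a \in s -> (\prod_(b <- s) zexpg (v b) (a == b)%:R = v a)%g.
Proof.
elim: s => //= b s IH /andP[nbs us]; rewrite big_cons inE.
case: eqVneq => [-> _|ab /= sa]; last by rewrite IH //= mul1g.
rewrite big_seq big1 /= ?mulg1 ?expg1 // => c sc.
by case: eqVneq => // bc; rewrite bc sc in nbs.
Qed.

End IntegerPowers.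

Lemma gmulf_zexpg (G H : groupType) (f : grhom G H) y i :
  f (zexpg y i) = zexpg (f y) i.
Proof. by case: i => n /=; rewrite ?gmulfXn ?gmulfXVn. Qed.

(** * Coordinates dual to the basic commutators *)
Section FreeGroupFunctionals.
Local Open Scope ring_scope.
Variables (m : nat) (F : groupType) (x : 'I_m -> F).
Hypothesis freeF : is_free_group x.

Section Representation.
Variables (M : zmodType) (u : fcomm m -> M -> M).
Hypothesis uD : forall t, {morph u t : v v' / v + v'}.
Variable rho : grhom F (addaut (nat -> M)).
Hypothesis rho_x : forall i, rho (x i) = unip (uD (Letter i)).

Lemma lead_ceval t : lead (wt t) (rho (ceval x t)) (lie_op pred0 u t).
Proof.
elim: t => [i|b IHb a IHa]; first by rewrite /= rho_x; apply: lead_unip.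
by rewrite /= gmulfR; apply: leadR; rewrite ?wt_gt0.
Qed.

Lemma lead_lcs k y : (0 < k)%N -> lcs F k y -> exists L, lead k (rho y) L.
Proof.
have sub k' : (0 < k')%N -> subgroup [set y | exists L, lead k' (rho y) L].
  move=> k0; split; first by rewrite /= gmulf1; eexists; apply: lead1.
  move=> z z' [L lL] [L' lL']; rewrite /= gmulfF.
  by eexists; apply: (leadM k0 lL); apply: leadV k0 lL'.
case: k => // k _; elim: k y => [|k IHk] y.
  move=> _; apply: (free_group_gen freeF (sub 1%N isT)) => i /=.
  by rewrite rho_x; eexists; apply: lead_unip.
rewrite lcsSS; move: y; apply: commg_sub_le; first exact: sub.
move=> z z' /IHk [L lL] _.
have [L' lL'] : [set y | exists L, lead 1 (rho y) L] z'.
  apply: (free_group_gen freeF (sub 1%N isT)) => i /=.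
  by rewrite rho_x; eexists; apply: lead_unip.
by rewrite /= gmulfR -[k.+2]addn1; eexists; apply: leadR lL lL'.
Qed.

End Representation.

(** The matrix coefficient that separates t0, applied to the coefficient of T^w
    in the representation x_i |-> 1 + T u_i: on gamma_w this coefficient is the
    leading term, which is additive, vanishes on gamma_(w+1) and takes the basic
    commutators of weight w to their Lie brackets. *)
Lemma slice_functional w t0 : (0 < w)%N -> exists phi : F -> int,
  [/\ forall y z, lcs F w y -> lcs F w z -> phi (y * z)%g = phi y + phi z,
      forall y, lcs F w.+1 y -> phi y = 0
    & forall t, basic t -> wt t = w -> phi (ceval x t) = (t == t0)%:R].
Proof.
move=> w0; have [M [u [eps [v0 [uD epsD sep]]]]] := separated0 w t0.
have [rho [rho_x _]] := freeF (fun i => unip (uD (Letter i))).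
exists (fun y => eps (rho y (degree0 v0) w)).
split=> [y z Ly Lz|y Ly|t bt wt_t].
- have [L lL] := lead_lcs rho_x w0 Ly; have [L' lL'] := lead_lcs rho_x w0 Lz.
  rewrite (lead_degree0 _ w0 lL) (lead_degree0 _ w0 lL') gmulfM.
  by rewrite (lead_degree0 _ w0 (leadM w0 lL lL')) epsD.
- have [L lL] := lead_lcs rho_x (isT : 0 < w.+1)%N Ly.
  rewrite (lead_degree0S _ w0 lL); apply: (addrI (eps 0)).
  by rewrite -epsD !addr0.
- have := lead_ceval rho_x t; rewrite wt_t => lt.
  by rewrite (lead_degree0 _ w0 lt) sep.
Qed.

Lemma lcs_quot_commute K w (y z : F) : (K <= w + w)%N ->
  lcs F w y -> lcs F w z ->
  commute (quot_proj (lcs_normal F K) y) (quot_proj (lcs_normal F K) z).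
Proof.
move=> Kw Ly Lz; rewrite /commute -!gmulfM; apply/quot_projP.
rewrite invgM -mulgA; apply: (lcs_le Kw).
by have := lcs_commg Lz Ly; rewrite commgEl /conjg mulgA mulgA -mulgA.
Qed.

(** The basic commutators of weights w0, ..., K - 1 form a basis of the
    abelian group gamma_w0 / gamma_K, here through its dual basis. Downward
    induction on w0: a coordinate on gamma_(w0+1) extends to gamma_w0 along
    the retraction r that divides y by its component on the basic commutators of weight
    w0; r is multiplicative modulo gamma_K since gamma_w0 is abelian modulo gamma_K. *)
Lemma lcs_functional K w0 t0 : (0 < w0)%N -> (K <= w0 + w0)%N ->
    basic t0 -> (w0 <= wt t0 < K)%N -> exists psi : F -> int,
  [/\ forall y z, lcs F w0 y -> lcs F w0 z -> psi (y * z)%g = psi y + psi z,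
      forall y, lcs F K y -> psi y = 0
    & forall t, basic t -> (w0 <= wt t < K)%N ->
        psi (ceval x t) = (t == t0)%:R].
Proof.
move=> w00 Kw bt0 /andP[wt0 t0K]; move Ed : (wt t0 - w0)%N => d.
elim: d w0 w00 Kw wt0 Ed => [|d IHd] w w0 Kw wt0 Ed.
  have Ew : wt t0 = w by lia.
  have [phi [phiD phi0 phiE]] := slice_functional t0 w0.
  exists phi; split=> // [y Ly|t bt /andP[wt tK]].
    by apply: phi0; apply: lcs_le Ly; lia.
  have [Et|ne] := eqVneq (Defs.wt t) w; first by rewrite phiE.
  rewrite phi0; last by apply: ceval_lcs_le; lia.
  by case: eqP => // Et; rewrite Et Ew eqxx in ne.
have [|||psi [psiD psi0 psiE]] := IHd w.+1 isT; try lia.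
have /choice [phi phiP] : forall t, exists phi : F -> int, _ :=
  fun t => slice_functional t w0.
have phiD t := let: And3 h _ _ := phiP t in h.
have phi0 t := let: And3 _ h _ := phiP t in h.
have phiE t := let: And3 _ _ h := phiP t in h.
pose T := [seq t <- undup (fcomm_list m w) | basic t && (wt t == w)].
(* corr y is the component of y on the basic commutators of weight w *)
pose corr y := (\prod_(t <- T) zexpg (ceval x t) (phi t y))%g.
pose r y := (y * (corr y)^-1)%g.
have TP t : t \in T -> basic t /\ wt t = w.
  by rewrite mem_filter => /andP[/andP[-> /eqP]].
have Lcorr y : lcs F w (corr y).
  apply: subgroup_prod; first exact: lcs_subgroup.
  move=> t /TP[_ wt_t]; apply: subgroup_zexpg; first exact: lcs_subgroup.
  by apply: ceval_lcs_le; rewrite wt_t.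
have Lr y : lcs F w y -> lcs F w (r y).
  by move=> Ly; apply: (lcs_subgroup F w).2.
pose q := quot_proj (lcs_normal F K).
have qM y z : q (y * z)%g = (q y * q z)%g by apply: gmulfM.
have qV y : q y^-1%g = (q y)^-1%g by apply: gmulfV.
have qC y z : lcs F w y -> lcs F w z -> commute (q y) (q z).
  exact: lcs_quot_commute.
have qcorr y z : lcs F w y -> lcs F w z ->
    q (corr (y * z)%g) = (q (corr y) * q (corr z))%g.
  move=> Ly Lz; rewrite /q /corr !gmulf_prod.
  under eq_bigr do rewrite gmulf_zexpg phiD //.
  under [X in (X * _)%g]eq_bigr do rewrite gmulf_zexpg.
  under [X in (_ * X)%g]eq_bigr do rewrite gmulf_zexpg.
  apply: prod_zexpgD => a b /TP[_ wa] /TP[_ wb].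
  by apply: qC; apply: ceval_lcs_le; rewrite ?wa ?wb.
have rM y z : lcs F w y -> lcs F w z ->
    exists2 k, lcs F K k & r (y * z)%g = (r y * r z * k)%g.
  move=> Ly Lz; exists ((r y * r z)^-1 * r (y * z))%g; last by rewrite mulVKg.
  apply/(quot_projP (lcs_normal F K)); rewrite -!/(q _).
  have qrC : commute (q (corr y))^-1%g (q (r z)).
    by apply/commute_sym/commuteV; apply: qC => //; apply: Lr.
  by rewrite qM [in LHS]/r qM qV -mulgA qrC /r !qM !qV qcorr // invgM -!mulgA.
have phi1 t : phi t 1%g = 0 by apply: phi0; exact: (subgroup1 (lcs_subgroup F w.+1)).
have rid : forall y, (forall t, phi t y = 0) -> r y = y.
  move=> y phiy; rewrite /r /corr big1 ?invg1 ?mulg1 // => t _.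
  by rewrite phiy.
have wK : (w.+1 <= K)%N by lia.
have LK : lcs F K `<=` lcs F w.+1 := lcs_le wK; have sL := lcs_subgroup F w.+1.
have rS y : lcs F w y -> lcs F w.+1 (r y).
  pose S := [set y | lcs F w y /\ lcs F w.+1 (r y)].
  have SM y' z : S y' -> S z -> S (y' * z)%g.
    move=> [Ly Ly'] [Lz Lz']; split; first exact: (subgroupM (lcs_subgroup F w)).
    have [k /LK Lk ->] := rM y' z Ly Lz.
    by apply: subgroupM => //; apply: subgroupM.
  have SV z : S z -> S (z^-1)%g.
    move=> [Lz Lz']; have LVz := subgroupV (lcs_subgroup F w) Lz.
    split=> //; have [k /LK Lk] := rM z z^-1%g Lz LVz.
    rewrite mulgV (rid _ phi1) -mulgA => /esym/mulg1_eq E.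
    rewrite -[r _](mulgK k) -E.
    by apply: subgroupM => //; apply: subgroupV.
  have sS : subgroup S.
    split=> [|y' z Sy Sz]; last by apply: SM => //; apply: SV.
    split; first exact: (subgroup1 (lcs_subgroup F w)).
    by rewrite rid //; apply: subgroup1.
  have LS : layer x w w.+1 `<=` S.
    move=> z [[t [bt /andP[wt1 wt2]] <-]|Lz]; last first.
      by split; [apply: (lcs_le _ Lz) | rewrite rid // => t; apply: phi0].
    have wt_t : wt t = w by lia.
    have Lt : lcs F w (ceval x t) by apply: ceval_lcs_le.
    split=> //; rewrite /r /corr.
    under eq_bigr do rewrite phiE //.
    rewrite prod_zexpg_delta ?mulgV ?filter_uniq ?undup_uniq //.
      exact: subgroup1.
    by rewrite mem_filter bt wt_t eqxx mem_undup mem_fcomm_list // wt_t.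
  move=> /(lcs_sub_layer (free_group_gen freeF) (i := w) (j := w.+1)) Gy.
  have/Gy : (0 < w <= w.+1)%N by rewrite w0 leqnSn.
  by move=> /(gen_sub sS LS)[].
exists (fun y => psi (r y)); split=> [y z Ly Lz|y Ly|t bt /andP[wt1 wt2]].
- have [k Lk ->] := rM y z Ly Lz; have Lk' := LK _ Lk.
  have Ly' := rS _ Ly; have Lz' := rS _ Lz; have Lyz := subgroupM sL Ly' Lz'.
  by rewrite (psiD _ _ Lyz Lk') (psiD _ _ Ly' Lz') (psi0 _ Lk) addr0.
- rewrite rid ?psi0 // => t; apply: phi0; exact: LK.
- have [wt_t|ne] := eqVneq (wt t) w; last first.
    rewrite rid ?psiE // => [|s]; first by lia.
    by apply: phi0; apply: ceval_lcs_le; lia.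
  have -> : r (ceval x t) = 1%g.
    rewrite /r /corr; under eq_bigr do rewrite phiE //.
    rewrite prod_zexpg_delta ?mulgV ?filter_uniq ?undup_uniq //.
    by rewrite mem_filter bt wt_t eqxx mem_undup mem_fcomm_list // wt_t.
  rewrite psi0; last exact: (subgroup1 (lcs_subgroup F K)).
  by case: eqP => // Et; rewrite Et in wt_t; lia.
Qed.

End FreeGroupFunctionals.

(** * The verbal subgroup and the denominator of the Baer invariant *)
Section CommutatorWords.
Variable F : groupType.
Implicit Types (f g : nat -> F) (k c n : nat).

Lemma weval_wgammaS f k c :
  weval f (wgamma k c.+2) = [~ weval f (wgamma k c.+1), f (k + c.+1)%N].
Proof.
have E : iota k.+1 c.+1 = iota k.+1 c ++ [:: (k + c.+1)%N].
  by rewrite -[X in iota _ X]addn1 iotaD /= addSnnS.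
by rewrite /wgamma !succnK E map_cat foldl_cat.
Qed.

Lemma eq_weval_wgamma f g k c :
  (forall i, (k <= i <= k + c)%N -> f i = g i) ->
  weval f (wgamma k c.+1) = weval g (wgamma k c.+1).
Proof.
elim: c => [|c IHc] fg; first by apply: fg; rewrite addn0 leqnn.
by rewrite !weval_wgammaS IHc ?fg // => [|i ik]; [lia | apply: fg; lia].
Qed.

Lemma weval_wgamma_lcs f k c : lcs F c.+1 (weval f (wgamma k c.+1)).
Proof.
by elim: c => [//|c IHc]; rewrite weval_wgammaS; apply: lcs_commgT.
Qed.

Lemma weval_wgamma1 f k c : f k = 1 -> weval f (wgamma k c.+1) = 1.
Proof. by move=> fk; elim: c => [//|c IHc]; rewrite weval_wgammaS IHc comm1g. Qed.

(** The first letter takes values in gamma_(n+1); n = 0 puts no constraint on it. *)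
Definition wgamma_values k c n : set F :=
  [set weval f (wgamma k c.+1) | f in [set f | lcs F n.+1 (f k)]].

(** gamma_(c+n+1) is obtained from gamma_(n+1) by c bracketings, the values of
    the word are closed under conjugation, and the letters are free to vary
    independently. *)
Lemma lcs_sub_wgamma k c n : lcs F (c + n.+1) `<=` gen (wgamma_values k c n).
Proof.
elim: c => [|c IHc] z Lz; first by apply: sub_gen; exists (fun=> z).
have nW : normal (gen (wgamma_values k c.+1 n)).
  apply: gen_normal => _ y [f Lf <-]; exists (fun i => f i ^ y).
    by apply: normalJ => //; apply: lcs_normal.
  by rewrite weval_conj.
move: z Lz; rewrite addSn addnS lcsSS; apply: commg_sub_le.
  exact: normal_subgroup.
move=> y z Ly _; rewrite -addnS in Ly.
apply: (@commg_gen_normal _ _ (wgamma_values k c n) [set z]) (IHc _ Ly) _ => //.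
  move=> _ _ [f Lf <-] ->; apply: sub_gen.
  exists (fun i => if i == (k + c.+1)%N then z else f i).
    by rewrite /=; case: eqP => // ?; lia.
  rewrite weval_wgammaS eqxx; congr [~ _, _]; apply: eq_weval_wgamma => i ik.
  by case: eqP => // ?; lia.
exact: sub_gen.
Qed.

(** Each letter lies in gamma_1, and is changed by an element n steps deeper; so
    is the value, since terms that involve several changes are deeper still. *)
Lemma weval_wgamma_perturb f g k c n :
    (forall i, lcs F n.+1 ((f i)^-1 * g i)) ->
  lcs F (c + n.+1) ((weval f (wgamma k c.+1))^-1 * weval g (wgamma k c.+1)).
Proof.
move=> fg; elim: c => [|c]; first exact: fg.
rewrite !weval_wgammaS => Ls; set t := (f (k + c.+1)%N)^-1 * g (k + c.+1)%N.
have -> : g (k + c.+1)%N = f (k + c.+1)%N * t by rewrite mulVKg.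
rewrite -(mulVKg (weval f (wgamma k c.+1)) (weval g _)).
have Lt : lcs F n.+1 t by apply: fg.
have Lu := weval_wgamma_lcs f k c.
apply: commg_congr; first exact: lcs_normal.
- by move=> a; rewrite addSn; apply: lcs_commgT.
- exact: lcs_commg.
- by apply: (lcs_le (j := c.+2 + n.+1)); [lia | apply: lcs_commg (lcs_commgT _ Lu) Lt].
Qed.

(** The two words have no letter in common, so one assignment serves both. *)
Lemma wgamma_disjoint f g k c l d : (k + c < l)%N ->
  exists h : nat -> F,
    [/\ forall i, (i <= k + c)%N -> h i = f i,
        forall i, (k + c < i)%N -> h i = g i
      & [~ weval f (wgamma k c.+1), weval g (wgamma l d.+1)]
        = [~ weval h (wgamma k c.+1), weval h (wgamma l d.+1)]].
Proof.
move=> kl; exists (fun i => if (i <= k + c)%N then f i else g i).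
split=> [i ->//|i|]; first by rewrite ltnNge => /negPf->.
by congr [~ _, _]; apply: eq_weval_wgamma => i ik; case: leqP => //; lia.
Qed.

Variables (c1 c2 : nat).
Local Notation V := [set wgamma2 c1.+1 c2.+1].

Lemma weval_wgamma2 f : weval f (wgamma2 c1.+1 c2.+1) =
  [~ weval f (wgamma 0 c1.+1), weval f (wgamma c1.+1 c2.+1)].
Proof. by []. Qed.

Lemma verbal_wgamma2 :
  verbal_subgroup V F = commg_sub (lcs F c1.+1) (lcs F c2.+1).
Proof.
apply/seteqP; split.
  apply: gen_sub => [|_ [_ -> [f ->]]]; first exact: gen_subgroup.
  by rewrite weval_wgamma2; apply: sub_commg; apply: weval_wgamma_lcs.
apply: commg_sub_le => [|a b La Lb]; first exact: gen_subgroup.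
apply: (@commg_gen_normal _ _ (wgamma_values 0 c1 0) (wgamma_values c1.+1 c2 0)).
- apply: gen_normal => _ y [v Vv [f ->]].
  by exists v => //; exists (fun i => f i ^ y); rewrite weval_conj.
- move=> _ _ [f _ <-] [g _ <-]; apply: sub_gen; exists (wgamma2 c1.+1 c2.+1) => //.
  have [h [_ _ ->]] := @wgamma_disjoint f g 0 c1 c1.+1 c2 (ltnSn _).
  by exists h.
- by apply: lcs_sub_wgamma; rewrite addn1.
- by apply: lcs_sub_wgamma; rewrite addn1.
Qed.

Lemma mulset_normal_sub (A B S : set F) :
  subgroup S -> A `<=` S -> B `<=` S -> mulset A B `<=` S.
Proof.
by move=> sS AS BS _ [a Aa [b Bb <-]]; apply: subgroupM => //; [apply: AS | apply: BS].
Qed.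

Lemma mulset_normal (A B : set F) : normal A -> normal B -> normal (mulset A B).
Proof.
move=> nA nB; have sA := normal_subgroup nA; have sB := normal_subgroup nB.
split; last first.
  move=> _ g [a Aa [b Bb <-]]; rewrite conjMg.
  by exists (a ^ g); [apply: normalJ | exists (b ^ g) => //; apply: normalJ].
split; first by exists 1; [|exists 1; rewrite ?mulg1 //]; apply: subgroup1.
move=> _ _ [a Aa [b Bb <-]] [a' Aa' [b' Bb' <-]].
exists (a * a'^-1 ^ (b * b'^-1)^-1).
  by apply: subgroupM => //; apply: normalJ => //; apply: subgroupV.
exists (b * b'^-1); first by apply: subgroupM => //; apply: subgroupV.
by rewrite /conjg !invgM !invgK !mulgA !(mulgK, mulgVK).
Qed.

Lemma sub_mulsetl (A B : set F) : subgroup B -> A `<=` mulset A B.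
Proof. by move=> sB a Aa; exists a => //; exists 1; rewrite ?mulg1 //; apply: subgroup1. Qed.

Lemma sub_mulsetr (A B : set F) : subgroup A -> B `<=` mulset A B.
Proof. by move=> sA b Bb; exists 1; [apply: subgroup1 | exists b; rewrite ?mul1g]. Qed.

(** Changing one letter by an element of gamma_(n+1) changes the half of the
    word in which it occurs by an element n steps deeper, and the resulting
    error terms lie in N. Conversely, a bracket of two left-normed commutators, one
    of which starts with r in gamma_(n+1), is the effect of changing
    that letter from 1 to r, as the word has the value 1 when that letter is 1. *)
Lemma baer_denominator_wgamma2 n :
  baer_denominator V (lcs F n.+1) =
  mulset (commg_sub (lcs F (c1 + n + 1)) (lcs F (c2 + 1)))
         (commg_sub (lcs F (c2 + n + 1)) (lcs F (c1 + 1))).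
Proof.
rewrite !addn1 -!addnS.
set N1 := commg_sub _ (lcs F c2.+1); set N2 := commg_sub _ (lcs F c1.+1).
have nN1 : normal N1 by apply: commg_sub_normal; apply: lcs_normal.
have nN2 : normal N2 by apply: commg_sub_normal; apply: lcs_normal.
have nD := baer_denominator_normal V (@lcs_normal F n.+1).
apply/seteqP; split; last first.
  apply: mulset_normal_sub; first exact: normal_subgroup.
    apply: commg_sub_le => [|a b La Lb]; first exact: normal_subgroup.
    apply: (@commg_gen_normal _ _ (wgamma_values 0 c1 n) (wgamma_values c1.+1 c2 0)).
    - exact: nD.
    - move=> _ _ [f Lf <-] [g _ <-]; apply: sub_gen.
      have [h [hf _ ->]] := @wgamma_disjoint f g 0 c1 c1.+1 c2 (ltnSn _).
      exists (wgamma2 c1.+1 c2.+1), (fun i => if i == 0%N then 1 else h i), 0%N, (f 0%N).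
      split=> //; rewrite !weval_wgamma2 [X in _ * [~ X, _]^-1]weval_wgamma1 //.
      rewrite comm1g invg1 mulg1; congr [~ _, _]; apply: eq_weval_wgamma => i ik /=.
        by case: eqP => // ->; rewrite mul1g hf.
      by case: eqP => // ?; lia.
    - exact: lcs_sub_wgamma.
    - by apply: lcs_sub_wgamma; rewrite addn1.
  apply: commg_sub_le => [|b a Lb La]; first exact: normal_subgroup.
  apply: (@commg_gen_normal _ _ (wgamma_values c1.+1 c2 n) (wgamma_values 0 c1 0)).
  - exact: nD.
  - move=> _ _ [g Lg <-] [f _ <-]; apply: (subgroupR_sym (normal_subgroup nD)).
    apply: sub_gen.
    have [h [_ hg ->]] := @wgamma_disjoint f g 0 c1 c1.+1 c2 (ltnSn _).
    exists (wgamma2 c1.+1 c2.+1), (fun i => if i == c1.+1 then 1 else h i), c1.+1,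
      (g c1.+1).
    split=> //; rewrite !weval_wgamma2 [X in _ * [~ _, X]^-1]weval_wgamma1 ?eqxx //.
    rewrite commg1 invg1 mulg1; congr [~ _, _]; apply: eq_weval_wgamma => i ik /=.
      by case: eqP => // ?; lia.
    by case: eqP => // ->; rewrite mul1g hg.
  - exact: lcs_sub_wgamma.
  - by apply: lcs_sub_wgamma; rewrite addn1.
apply: gen_sub; first exact/normal_subgroup/mulset_normal.
have nN := mulset_normal nN1 nN2; have sN := normal_subgroup nN.
move=> _ [_ [f [i [r [-> Lr ->]]]]]; rewrite !weval_wgamma2.
set f' := [eta _ with _ |-> _].
have ff' j : lcs F n.+1 ((f j)^-1 * f' j).
  by rewrite /f' /=; case: eqP => [->|_]; rewrite ?mulKg // mulVg; apply: subgroup1; apply: lcs_subgroup.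
have same k c : ~~ (k <= i <= k + c)%N ->
    weval f' (wgamma k c.+1) = weval f (wgamma k c.+1).
  move=> ik; apply: eq_weval_wgamma => j jk; rewrite /f' /=; case: eqP => // ji.
  by rewrite -ji jk in ik.
set u := weval f _; set u' := weval f' _; set w := weval f _; set w' := weval f' _.
have Lc : lcs F (c1.+1 + c2.+1) [~ u, w].
  by apply: lcs_commg; apply: weval_wgamma_lcs.
(* an element as deep as s commutes with [u, w] modulo N *)
have J s : N1 [~ [~ u, w], s] \/ N2 [~ [~ u, w], s] ->
    mulset N1 N2 ([~ u, w] ^ s * [~ u, w]^-1).
  move=> Ns; have {Ns}Ns : mulset N1 N2 [~ [~ u, w], s].
    by case: Ns; [apply: sub_mulsetl | apply: sub_mulsetr]; apply: normal_subgroup.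
  have -> : [~ u, w] ^ s * [~ u, w]^-1 = [~ [~ u, w], s] ^ [~ u, w]^-1.
    by move: [~ u, w] => c; rewrite /commg /conjg invgK !mulgA mulgV mul1g.
  exact: normalJ.
have [le_i|lt_i] := leqP i c1.
  have -> : w' = w by apply: same; lia.
  have Ls := weval_wgamma_perturb 0 c1 ff'; rewrite -/u -/u' in Ls.
  rewrite -(mulVKg u u'); move: (u^-1 * u') Ls => s Ls.
  have N1s : N1 [~ s, w] by apply: sub_commg => //; apply: weval_wgamma_lcs.
  have -> : [~ u * s, w] * [~ u, w]^-1
      = [~ u, w] ^ s * [~ u, w]^-1 * [~ s, w] ^ [~ u, w]^-1.
    rewrite commMg; move: ([~ u, w] ^ s)%g [~ s, w] [~ u, w] => a b c.
    by rewrite /conjg invgK !mulgA mulgVK.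
  apply: (subgroupM sN); last first.
    by apply: (normalJ _ nN); apply: sub_mulsetl; first exact: normal_subgroup.
  apply: J; left; apply: (subgroupR_sym (normal_subgroup nN1)).
  by apply: sub_commg => //; apply: lcs_le Lc; lia.
have -> : u' = u by apply: same; lia.
have Ls := weval_wgamma_perturb c1.+1 c2 ff'; rewrite -/w -/w' in Ls.
rewrite -(mulVKg w w'); move: (w^-1 * w') Ls => s Ls.
have -> : [~ u, w * s] * [~ u, w]^-1 = [~ u, s] * ([~ u, w] ^ s * [~ u, w]^-1).
  by rewrite mulgA; congr (_ * _); rewrite /commg /conjg !invgM !mulgA !(mulgK, mulgVK).
apply: (subgroupM sN).
  apply: sub_mulsetr; first exact: normal_subgroup.
  apply: (subgroupR_sym (normal_subgroup nN2)).
  by apply: sub_commg => //; apply: weval_wgamma_lcs.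
apply: J; right; apply: (subgroupR_sym (normal_subgroup nN2)).
by apply: sub_commg => //; apply: lcs_le Lc; lia.
Qed.

End CommutatorWords.

(** * A criterion for free abelian quotients *)
Section FreeAbelianCriterion.
Local Open Scope ring_scope.
Variables (F : groupType) (S : set F) (sS : subgroup S).

Section Functional.
Variable psi : F -> int.
Hypothesis psiM : forall y z, S y -> S z -> psi (y * z)%g = psi y + psi z.

Lemma functional1 : psi 1%g = 0.
Proof.
by apply: (addrI (psi 1%g)); rewrite -psiM ?mulg1 ?addr0 //; apply: subgroup1.
Qed.

Lemma functionalV y : S y -> psi y^-1%g = - psi y.
Proof.
move=> Sy; apply/eqP; rewrite -addr_eq0 -psiM ?mulVg ?functional1 //.
exact: subgroupV.
Qed.

Lemma functional_zexpg y k : S y -> psi (zexpg y k) = k * psi y.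
Proof.
move=> Sy; have SX n : S (y ^+ n)%g := subgroup_zexpg (Posz n) sS Sy.
have psiX n : psi (y ^+ n)%g = n%:Z * psi y.
  elim: n => [|n IHn]; first by rewrite mul0r functional1.
  by rewrite expgS psiM // IHn; lia.
by case: k => n /=; rewrite ?functionalV // psiX // NegzE mulNr.
Qed.

Lemma functional_prod (I : eqType) (s : seq I) (v : I -> F) (k : I -> int) :
    (forall a, a \in s -> S (v a)) ->
  psi (\prod_(a <- s) zexpg (v a) (k a))%g = \sum_(a <- s) k a * psi (v a).
Proof.
elim: s => [_|a s IHs Sv]; first by rewrite !big_nil functional1.
have Sv' b : b \in s -> S (v b) by move=> bs; apply: Sv; rewrite inE bs orbT.
rewrite !big_cons psiM ?IHs ?functional_zexpg //; first by apply: Sv; rewrite mem_head.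
  by apply: subgroup_zexpg => //; apply: Sv; rewrite mem_head.
by apply: subgroup_prod => // b bs; apply: subgroup_zexpg => //; apply: Sv'.
Qed.

Lemma functional_kernel : subgroup [set y | S y /\ psi y = 0].
Proof.
split; first by split; [apply: subgroup1 | apply: functional1].
move=> y z [Sy y0] [Sz z0]; split; first exact: sS.2.
by rewrite psiM ?functionalV ?y0 ?z0 ?subrr //; apply: subgroupV.
Qed.

End Functional.

(** The functionals psi vanish on D, hence pass to the quotient and read off the
    exponents of a relation; this also shows that distinct indices
    in T give distinct cosets. *)
Lemma free_abelian_criterion (I : eqType) (T : set I) (v : I -> F)
    (D : set F) (nD : normal D) :
    (forall y z, S y -> S z -> D [~ y, z]%g) ->
    (forall t, T t -> S (v t)) ->
    S `<=` gen (v @` T `|` D) ->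
    (forall t, T t -> exists psi : F -> int,
       [/\ forall y z, S y -> S z -> psi (y * z)%g = psi y + psi z,
           forall y, D y -> psi y = 0
         & forall t', T t' -> psi (v t') = (t' == t)%:R]) ->
  free_abelian_with_basis (quot_proj nD @` S)
    [set d | exists2 t, T t & quot_proj nD @^-1` [set d] = left_coset (v t) D].
Proof.
move=> SC ST Sgen dual; have sD := normal_subgroup nD.
have q1 : quot_proj nD 1%g = 1%g by apply: gmulf1.
have basisE t d : quot_proj nD @^-1` [set d] = left_coset (v t) D <->
    d = quot_proj nD (v t).
  split=> [E|->].
    have : left_coset (v t) D (v t) by exists 1%g; [apply: subgroup1 | rewrite mulg1].
    by rewrite -E => /= ->.
  apply/seteqP; split=> y /=.
    by move=> /esym/quot_projP Dy; exists ((v t)^-1 * y)%g => //; rewrite mulVKg.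
  by move=> [z Dz <-]; apply/esym/quot_projP; rewrite mulKg.
split.
- move=> _ _ [y Sy <-] [z Sz <-]; rewrite /commute -!gmulfM; apply/quot_projP.
  rewrite invgM -mulgA; have := SC z y Sz Sy.
  by rewrite /commg /conjg !mulgA.
- apply/seteqP; split.
    apply: gen_sub => [|d [t Tt /basisE ->]]; last by exists (v t) => //; apply: ST.
    split; first by exists 1%g; [apply: subgroup1 | rewrite gmulf1].
    move=> _ _ [y Sy <-] [z Sz <-]; exists (y * z^-1)%g; first exact: sS.2.
    by rewrite gmulfF.
  move=> _ [y /Sgen Gy <-]; set B := gen _.
  have sB : subgroup B by apply: gen_subgroup.
  suff H : gen (v @` T `|` D) `<=` [set y | B (quot_proj nD y)] by apply: H.
  apply: gen_sub.
    split; first by rewrite /= gmulf1; apply: subgroup1.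
    by move=> z z' Bz Bz'; rewrite /= gmulfF; apply: sB.2.
  move=> z [[t Tt <-]|Dz] /=; first by apply: sub_gen; exists t => //; apply/basisE.
  have -> : quot_proj nD z = 1%g.
    by rewrite -q1; apply/esym/quot_projP; rewrite invg1 mul1g.
  exact: subgroup1.
move=> s k us sB prod1 b0 b0s.
have [t0 Tt0 _] := sB b0 b0s.
have /choice [tau tauP] : forall b, exists t, b \in s -> T t /\ b = quot_proj nD (v t).
  move=> b; have [bs|_] := boolP (b \in s); last by exists t0.
  by have [t Tt /basisE E] := sB b bs; exists t.
have [psi [psiM psiD psiv]] := dual (tau b0) (tauP _ b0s).1.
have Ds : D (\prod_(b <- s) zexpg (v (tau b)) (k b))%g.
  have DE y : quot_proj nD 1%g = quot_proj nD y -> D y.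
    by move/quot_projP; rewrite invg1 mul1g.
  apply: DE; rewrite q1 -prod1 gmulf_prod !big_seq; apply: eq_bigr => b bs.
  by rewrite gmulf_zexpg {1}(tauP b bs).2.
have := psiD _ Ds; rewrite functional_prod // => [|b bs]; last first.
  by apply: ST; apply: (tauP b bs).1.
rewrite (bigD1_seq b0) //= psiv ?eqxx; last exact: (tauP b0 b0s).1.
rewrite mulr1 big_seq_cond big1 ?addr0 // => b /andP[bs ne].
rewrite psiv; last exact: (tauP b bs).1.
case: eqP => [E|_]; last by rewrite mulr0.
by rewrite (tauP b bs).2 (tauP b0 b0s).2 E eqxx in ne.
Qed.

End FreeAbelianCriterion.

(** * Brackets of basic commutators modulo N *)
Section OuterCommutators.
Local Open Scope nat_scope.
Variables (m n c1 c2 : nat) (F : groupType) (x : 'I_m -> F).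
Hypotheses (n0 : 0 < n) (le_c : c2 <= c1) (hc : 2 * n + c1 < 2 * c2 + 2).
Hypothesis freeF : is_free_group x.
Implicit Types (a b t : fcomm m).

Let V2 := commg_sub (lcs F c1.+1) (lcs F c2.+1).
Let N1 := commg_sub (lcs F (c1 + n + 1)) (lcs F (c2 + 1)).
Let N2 := commg_sub (lcs F (c2 + n + 1)) (lcs F (c1 + 1)).
Let N := mulset N1 N2.
Let T : set (fcomm m) := commsA m n c1 c2 `\` commsC m n c1 c2.

(** The right component of b has at most half the weight of b, hence is lighter
    than a. *)
Lemma basic_Bracket b a : basic b -> basic a -> fcomm_lt a b ->
  wt b < 2 * wt a -> basic (Bracket b a).
Proof.
move=> bb ba lt_ab w; rewrite /= bb ba lt_ab /=.
case: b bb lt_ab w => // b1 b2 /and4P[_ _ /fcomm_lt_wt w12 _] _ /= w.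
by apply/orP; right; apply: wt_fcomm_lt; lia.
Qed.

Let nN1 : normal N1.
Proof. by apply: commg_sub_normal; apply: lcs_normal. Qed.
Let nN2 : normal N2.
Proof. by apply: commg_sub_normal; apply: lcs_normal. Qed.
Let nN : normal N.
Proof. exact: mulset_normal. Qed.
Let sN := normal_subgroup nN.

Let N1P y z : lcs F (c1 + n + 1) y -> lcs F (c2 + 1) z -> N [~ y, z].
Proof.
by move=> Ly Lz; apply: sub_mulsetl; [apply: normal_subgroup | apply: sub_commg].
Qed.

Let N2P y z : lcs F (c2 + n + 1) y -> lcs F (c1 + 1) z -> N [~ y, z].
Proof.
by move=> Ly Lz; apply: sub_mulsetr; [apply: normal_subgroup | apply: sub_commg].
Qed.

Let V2_lcs : V2 `<=` lcs F (c1.+1 + c2.+1).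
Proof.
apply: commg_sub_le => [|a b La Lb]; first exact: lcs_subgroup.
exact: lcs_commg.
Qed.

Lemma outer_commutators_abelian y z : V2 y -> V2 z -> N [~ y, z].
Proof.
by move=> /V2_lcs Ly /V2_lcs Lz; apply: N1P; [apply: lcs_le Ly | apply: lcs_le Lz]; lia.
Qed.

Lemma bracket_basis_basic t : T t -> basic t /\ c1.+1 + c2.+1 <= wt t < c1 + c2 + 2 * n + 1.
Proof.
move=> [[b [a [-> [bb ba lt_ab /andP[b1 b2] /andP[a1 a2]]]]] _].
by split=> /=; [apply: basic_Bracket => //; lia | lia].
Qed.

Lemma bracket_basis_mem t : T t -> V2 (ceval x t).
Proof.
move=> [[b [a [-> [bb ba lt_ab /andP[b1 b2] /andP[a1 a2]]]]] _] /=.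
by apply: sub_commg; apply: ceval_lcs_le; lia.
Qed.

(** A bracket of two basic commutators of the relevant weights lies, up to
    orientation, in A: if its first entry is the smaller one, both weights lie
    between p and q + n - 1, and the entries may be exchanged. If it also lies
    in C, then it belongs to [gamma_(q+n), gamma_p]. *)
Lemma bracket_basis_span : V2 `<=` gen (ceval x @` T `|` N).
Proof.
set S := gen _; have sS : subgroup S by apply: gen_subgroup.
have NS : N `<=` S by move=> y Ny; apply: sub_gen; right.
have SV2 : S `<=` lcs F (c1.+1 + c2.+1).
  apply: gen_sub; first exact: lcs_subgroup.
  move=> y [[t /bracket_basis_mem/V2_lcs Lt <-]//|].
  move: y; apply: mulset_normal_sub; first exact: lcs_subgroup.
    apply: commg_sub_le => [|a b La Lb]; first exact: lcs_subgroup.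
    by apply: lcs_le (lcs_commg La Lb); lia.
  apply: commg_sub_le => [|a b La Lb]; first exact: lcs_subgroup.
  by apply: lcs_le (lcs_commg La Lb); lia.
have SJ y h : S y -> lcs F c2.+1 h -> S (y ^ h)%g.
  move=> Sy Lh; rewrite conjg_mulR; apply: (subgroupM sS) => //; apply: NS.
  apply: N1P; last by rewrite addn1.
  by apply: lcs_le (SV2 _ Sy); lia.
have pair b a : basic b -> basic a -> fcomm_lt a b -> c1 < wt b <= c1 + n ->
    c2 < wt a <= c2 + n -> S [~ ceval x b, ceval x a].
  move=> bb ba lt_ab wb wa; have [[b' [a' [[-> ->] [_ _ _ [wb' wa'] _]]]]|nC] :=
    pselect (commsC m n c1 c2 (Bracket b a)).
    by apply: NS; apply: N2P; apply: ceval_lcs_le; lia.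
  apply: sub_gen; left; exists (Bracket b a) => //; split=> //.
  by exists b, a; split=> //; split=> //; lia.
have Lay i : lcs F i.+1 `<=` gen (layer x i.+1 (i + n).+1).
  by apply: (lcs_sub_layer (free_group_gen freeF)); lia.
apply: commg_sub_le => // y z /Lay Ly /Lay Lz.
apply: (commg_gen (lcs_subgroup F c2.+1) sS SJ) Ly Lz.
- have H : layer x c1.+1 (c1 + n).+1 `<=` lcs F c1.+1 by apply: layer_sub_lcs; lia.
  by move=> u /H; apply: lcs_le; lia.
- by apply: layer_sub_lcs; lia.
move=> u v [[b [bb wb] <-]|Lu]; last first.
  move=> Lv; apply: NS; apply: N1P; first by rewrite addn1.
  by rewrite addn1; apply: (layer_sub_lcs (x := x) (j := (c2 + n).+1)) Lv; lia.
case=> [[a [ba wa] <-]|Lv]; last first.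
  apply: NS; apply: (subgroupR_sym sN); apply: N2P; first by rewrite addn1.
  by apply: ceval_lcs_le; lia.
have /or3P[lt_ba|/eqP->|lt_ab] := fcomm_lt_total b a.
- apply: (subgroupR_sym sS); have := fcomm_lt_wt lt_ba => le_ba.
  by apply: pair => //; lia.
- by rewrite commgg; apply: subgroup1.
- by apply: pair => //; lia.
Qed.

(** The functional is the coordinate of t on gamma_(p+q) / gamma_K. Its kernel
    contains N: modulo gamma_K, both factors of N are generated by brackets of basic
    commutators which are again basic, and none of which lies in A - C, either
    because a weight exceeds the bounds of A or because the bracket is in C. *)
Lemma bracket_basis_dual t : T t -> exists psi : F -> int,
  [/\ forall y z, V2 y -> V2 z -> psi (y * z)%g = (psi y + psi z)%R,
      forall y, N y -> psi y = 0%R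
    & forall t', T t' -> psi (ceval x t') = (t' == t)%:R%R].
Proof.
move=> Tt; have [bt wtt] := bracket_basis_basic Tt; set w := c1.+1 + c2.+1.
pose K := c1 + c2 + 2 * n + 1.
have [||psi [psiM psi0 psiE]] := lcs_functional freeF (_ : 0 < w) (_ : K <= w + w) bt wtt.
- by [].
- by rewrite /K /w; lia.
exists psi; split=> [y z /V2_lcs Ly /V2_lcs Lz|y|t' /bracket_basis_basic[bt' wt']]; last 1 first.
- exact: psiE.
- exact: psiM.
pose Z := [set y | lcs F w y /\ psi y = 0%R].
have sZ : subgroup Z by apply: functional_kernel => //; apply: lcs_subgroup.
have LZ : lcs F K `<=` Z.
  move=> {}y Ly; split; last exact: psi0.
  by apply: lcs_le Ly; rewrite /K /w; lia.
have ZJ y' h : Z y' -> lcs F c2.+1 h -> Z (y' ^ h)%g.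
  move=> Zy' Lh; rewrite conjg_mulR; apply: (subgroupM sZ) => //; apply: LZ.
  by apply: lcs_le (lcs_commg Zy'.1 Lh); rewrite /K /w; lia.
have Zbr b a : basic (Bracket b a) -> w <= wt b + wt a -> ~ T (Bracket b a) ->
    Z [~ ceval x b, ceval x a].
  move=> bba wba nT; have [ltK|geK] := ltnP (wt b + wt a) K; last first.
    by apply: LZ; apply: (@ceval_lcs_le _ _ _ _ (Bracket b a)).
  split; first exact: (@ceval_lcs_le _ _ _ _ (Bracket b a)).
  rewrite (psiE (Bracket b a)) //= ?wba //.
  by case: eqP => // E; rewrite E in nT.
have Lay i j : 0 < i <= j -> lcs F i `<=` gen (layer x i j).
  exact: (lcs_sub_layer (free_group_gen freeF)).
have layer_c2 i j : c2 < i <= j -> layer x i j `<=` lcs F c2.+1.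
  move=> ij; have H : layer x i j `<=` lcs F i by apply: layer_sub_lcs; lia.
  by move=> u /H; apply: lcs_le; lia.
suff : N `<=` Z by move=> NZ /NZ[].
apply: mulset_normal_sub => //.
  apply: commg_sub_le => // u v Lu Lv.
  have /Lay/(_ _ Lu) Gu : 0 < c1 + n + 1 <= c1 + 2 * n by lia.
  have /Lay/(_ _ Lv) Gv : 0 < c2 + 1 <= c2 + n by lia.
  apply: (commg_gen (lcs_subgroup F c2.+1) sZ ZJ) Gu Gv; try by apply: layer_c2; lia.
  move=> y1 y2 [[b [bb wb] <-]|L1] Hy2.
    case: Hy2 => [[a [ba wa] <-]|L2]; last first.
      by apply: LZ; apply: lcs_le (lcs_commg (ceval_lcs x b) L2); rewrite /K; lia.
    have lt_ab : fcomm_lt a b by apply: wt_fcomm_lt; lia.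
    apply: Zbr; [by apply: basic_Bracket => //; lia | by rewrite /w; lia |].
    by move=> [[b' [a' [[<- <-] [_ _ _ wb' _]]]] _]; lia.
  have L2 : lcs F c2.+1 y2 by apply: layer_c2 Hy2; lia.
  by apply: LZ; apply: lcs_le (lcs_commg L1 L2); rewrite /K; lia.
apply: commg_sub_le => // u v Lu Lv.
have /Lay/(_ _ Lu) Gu : 0 < c2 + n + 1 <= c2 + 2 * n by lia.
have /Lay/(_ _ Lv) Gv : 0 < c1 + 1 <= c1 + n by lia.
apply: (commg_gen (lcs_subgroup F c2.+1) sZ ZJ) Gu Gv; try by apply: layer_c2; lia.
move=> y1 y2 [[b [bb wb] <-]|L1] Hy2; last first.
  have L2 : lcs F (c1 + 1) y2 by apply: layer_sub_lcs Hy2; lia.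
  by apply: LZ; apply: lcs_le (lcs_commg L1 L2); rewrite /K; lia.
case: Hy2 => [[a [ba wa] <-]|L2]; last first.
  by apply: LZ; apply: lcs_le (lcs_commg (ceval_lcs x b) L2); rewrite /K; lia.
have /or3P[lt_ba|/eqP->|lt_ab] := fcomm_lt_total b a.
- apply: (subgroupR_sym sZ).
  apply: Zbr; [by apply: basic_Bracket => //; lia | by rewrite /w; lia |].
  by move=> [[b' [a' [[<- <-] [_ _ _ _ wa']]]] _]; lia.
- by rewrite commgg; apply: subgroup1.
- apply: Zbr; [by apply: basic_Bracket => //; lia | by rewrite /w; lia |].
  move=> [[b' [a' [[<- <-] [_ _ _ wb' wa']]]]]; apply.
  by exists b, a; split=> //; split=> //; lia.
Qed.

Lemma outer_sub_lcs : V2 `<=` lcs F n.+1.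
Proof. by move=> y /V2_lcs; apply: lcs_le; lia. Qed.

End OuterCommutators.

(** * The Baer invariant *)

Theorem theorem2p8 (n m c1 c2 : nat)
    (n_gt0 : (0 < n)%N) (m_gt0 : (0 < m)%N)
    (c1_gt0 : (0 < c1)%N) (c2_gt0 : (0 < c2)%N)
    (le_c2_c1 : (c2 <= c1)%N)
    (lt_n_c : (2 * n%:Z - 2 < 2 * c2%:Z - c1%:Z)%R)
    (P : groupType) (inj : 'I_m -> grhom (Algebra.to_multiplicative int) P)
    (freeP : is_free_product inj)
    (G := nilpotent_product n inj)
    (F : groupType) (x : 'I_m -> F) (freeF : is_free_group x)
    (pi : grhom F G) (pi_surj : range pi = setT)
    (pi_ker : kernel pi = lcs F n.+1)
    (V := [set wgamma2 c1.+1 c2.+1])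
    (N := mulset (commg_sub (lcs F (c1 + n + 1)) (lcs F (c2 + 1)))
                 (commg_sub (lcs F (c2 + n + 1)) (lcs F (c1 + 1)))) :
  free_abelian_with_basis (baer_invariant V pi)
    [set d | exists2 a, (commsA m n c1 c2 `\` commsC m n c1 c2) a &
       quot_proj _ @^-1` [set d] = left_coset (ceval x a) N].
Proof.
have hc : (2 * n + c1 < 2 * c2 + 2)%N by lia.
have DN : baer_denominator V (kernel pi) = N.
  by rewrite pi_ker baer_denominator_wgamma2.
have VE : kernel pi `&` verbal_subgroup V F = commg_sub (lcs F c1.+1) (lcs F c2.+1).
  rewrite pi_ker verbal_wgamma2; apply: setIidr; exact: outer_sub_lcs.
rewrite /baer_invariant VE -DN.
apply: free_abelian_criterion; rewrite ?DN.
- exact: gen_subgroup.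
- exact: outer_commutators_abelian.
- exact: bracket_basis_mem.
- exact: bracket_basis_span.
- exact: bracket_basis_dual.
Qed.
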